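(* For all integers $n\ge 13$, $$\operatorname{xcs}(P_{\mathrm{ST}}(K_n))\ \ge\ \binom n3 .$$ Consequently, $\operatorname{xcs}(P_{\mathrm{ST}}(K_n))=\Theta(n^3)$ (as $n\to\infty$).
   Context: $K_n=([n],E_n)$ is the complete graph on $[n]=\{1,\dots,n\}$, and $$P_{\mathrm{ST}}(K_n)=\operatorname{conv}\{\chi^T\in\{0,1\}^{E_n}: T\text{ is a spanning tree of }K_n\}\subseteq\mathbb R^{E_n}$$ is its spanning tree polytope, where $\chi^T$ is the characteristic vector of the edge set of $T$. The symmetric group $S_n$ acts on $[n]$ by relabeling vertices, hence on $E_n$, on $\mathbb R^{E_n}$ by permuting coordinates, on spanning trees, and on $P_{\mathrm{ST}}(K_n)$. Let a finite group $G$ act affinely on $\mathbb R^m$. A polytope $P\subseteq\mathbb R^m$ is a $G$-polytope if $gP=P$ for every $g\in G$. An extension (extended formulation) of $P$ is a polyhedron $Q\subseteq\mathbb R^d$ (for some $d$) together with an affine map $p:\mathbb R^d\to\mathbb R^m$ such that $p(Q)=P$. Its size is the number of facet-defining inequalities of $Q$, i.e. the number of facets of $Q$; equations are not counted. If $P$ is a $G$-polytope, a $G$-symmetric extension is an extension $p:Q\to P$ together with an affine action of $G$ on $Q$ such that $p(gq)=g\,p(q)$ for all $g\in G$, $q\in Q$. The symmetric extension complexity $\operatorname{xcs}_G(P)$ is the minimum size of a $G$-symmetric extension of $P$, and $\operatorname{xcs}(P_{\mathrm{ST}}(K_n))$ abbreviates $\operatorname{xcs}_{S_n}(P_{\mathrm{ST}}(K_n))$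 for the vertex-relabeling action. *)

(* Defs.v *)
From mathcomp Require Import all_boot all_order all_algebra all_fingroup.
From mathcomp Require Import all_classical all_reals all_analysis.

Set Implicit Arguments.
Unset Strict Implicit.
Unset Printing Implicit Defensive.

Import Order.TTheory GRing.Theory Num.Theory.
Import numFieldNormedType.Exports.

Local Open Scope classical_set_scope.
Local Open Scope ring_scope.

(* The coordinate space R^I; R^d is vec R 'I_d. *)
Notation vec R I := {ffun I -> R^o}.

Section Polyhedra.
Variable R : realType.

Definition dot (I : finType) (a x : vec R I) : R := \sum_i a i * x i.

Definition polyhedron (I : finType) (Q : set (vec R I)) : Prop :=
  exists (k : nat) (a : 'I_k -> vec R I) (b : 'I_k -> R),
    Q = [set x | forall i, dot (a i) x <= b i].

Definition convex_hull (I : finType) (S : set (vec R I)) : set (vec R I) :=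
  [set x | exists (k : nat) (w : 'I_k -> R) (s : 'I_k -> vec R I),
    [/\ forall i, S (s i), forall i, 0 <= w i, \sum_i w i = 1
      & x = \sum_i w i *: s i]].

Definition face (I : finType) (Q F : set (vec R I)) : Prop :=
  exists (c : vec R I) (delta : R),
    (forall x, Q x -> dot c x <= delta) /\
    F = Q `&` [set x | dot c x = delta].

Definition proper_face (I : finType) (Q F : set (vec R I)) : Prop :=
  [/\ face Q F, F !=set0 & F != Q].

(* A facet is an inclusionwise maximal proper nonempty face; in particular an
   affine subspace (e.g. a point) has no facet. *)
Definition facet (I : finType) (Q F : set (vec R I)) : Prop :=
  proper_face Q F /\ forall F', proper_face Q F' -> F `<=` F' -> F' = F.

Definition has_nb_facets (I : finType) (Q : set (vec R I)) (k : nat) : Prop :=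
  ([set F | facet Q F] #= `I_k)%card.

Definition affine_map (I J : finType) (f : vec R I -> vec R J) : Prop :=
  exists (L : {linear vec R I -> vec R J}) (b : vec R J),
    forall x, f x = L x + b.

Definition extension (I : finType) (P : set (vec R I)) (d : nat)
    (Q : set (vec R 'I_d)) (p : vec R 'I_d -> vec R I) : Prop :=
  [/\ polyhedron Q, affine_map p & p @` Q = P].

End Polyhedra.

Section SymmetricExtensions.
Variables (R : realType) (gT : finGroupType).

(* MathComp actions are right actions.  Those of 'S_n, whose product s * t is
   "s, then t", are the left actions of the symmetric group for the usual
   composition.  In general, right actions of G correspond to left actions of G
   through g |-> g^-1, which changes neither orbits nor equivariance. *)
Definition affine_action_on (I : finType) (Q : set (vec R I))
    (rho : vec R I -> gT -> vec R I) : Prop :=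
  [/\ forall g, affine_map (rho ^~ g),
      forall q g, Q q -> Q (rho q g),
      forall q, Q q -> rho q 1%g = q
    & forall q g h, Q q -> rho q (g * h)%g = rho (rho q g) h].

Definition symmetric_extension (I : finType) (to : {action gT &-> vec R I})
    (P : set (vec R I)) (d : nat) (Q : set (vec R 'I_d))
    (p : vec R 'I_d -> vec R I) : Prop :=
  extension P Q p /\
  exists rho : vec R 'I_d -> gT -> vec R 'I_d,
    affine_action_on Q rho /\
    forall g q, Q q -> p (rho q g) = to (p q) g.

Definition symmetric_extension_size (I : finType)
    (to : {action gT &-> vec R I}) (P : set (vec R I)) (k : nat) : Prop :=
  exists (d : nat) (Q : set (vec R 'I_d)) (p : vec R 'I_d -> vec R I),
    symmetric_extension to P Q p /\ has_nb_facets Q k.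

(* The minimum size; 0 by convention if there is no symmetric extension. *)
Definition xcs (I : finType) (to : {action gT &-> vec R I})
    (P : set (vec R I)) : nat :=
  xget 0%N [set k | symmetric_extension_size to P k /\
    forall j, symmetric_extension_size to P j -> (k <= j)%N].

Lemma xcs_min (I : finType) (to : {action gT &-> vec R I})
    (P : set (vec R I)) (k : nat) :
  symmetric_extension_size to P k ->
  symmetric_extension_size to P (xcs to P) /\ (xcs to P <= k)%N.
Proof.
move=> sk; rewrite /xcs; case: xgetP => [m _ [sm mmin]|none].
  by split=> //; exact: mmin.
have ex : exists m, `[< symmetric_extension_size to P m >].
  by exists k; apply/asboolP.
case: (ex_minnP ex) => m /asboolP sm mmin.
by case: (none m); split=> // j sj; apply/mmin/asboolP.
Qed.

End SymmetricExtensions.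

Section SpanningTreePolytope.
Variables (R : realType) (n : nat).

Definition edge := {e : {set 'I_n} | #|e| == 2%N}.

Definition adj (T : {set edge}) : rel 'I_n :=
  fun u v => [exists e in T, val e == [set u; v]%SET].

Definition spanning_tree (T : {set edge}) : Prop :=
  (forall u v, connect (adj T) u v) /\
  (forall c : seq 'I_n, (2 < size c)%N -> ~ ucycle (adj T) c).

Definition chi (T : {set edge}) : vec R edge := [ffun e => (e \in T)%:R].

Definition P_ST : set (vec R edge) :=
  convex_hull [set chi T | T in [set T | spanning_tree T]].

Lemma edge_relabel_subproof (s : 'S_n) (e : edge) :
  #|[set s v | v in val e]%SET| == 2%N.
Proof. by rewrite card_imset ?(valP e)//; exact: perm_inj. Qed.

Definition edge_relabel (s : 'S_n) (e : edge) : edge :=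
  exist (fun f : {set 'I_n} => #|f| == 2%N) _ (edge_relabel_subproof s e).

Definition vec_relabel (x : vec R edge) (s : 'S_n) : vec R edge :=
  [ffun e => x (edge_relabel s^-1%g e)].

Lemma vec_relabel1 : vec_relabel^~ 1%g =1 id.
Proof.
move=> x; apply/ffunP => e; rewrite ffunE; congr (x _); apply: val_inj => /=.
by rewrite -[RHS]imset_id; apply: eq_imset => v; rewrite invg1 perm1.
Qed.

Lemma vec_relabelM (x : vec R edge) : act_morph vec_relabel x.
Proof.
move=> s t; apply/ffunP => e; rewrite !ffunE; congr (x _); apply: val_inj => /=.
by rewrite -imset_comp; apply: eq_imset => v; rewrite invMg permM.
Qed.

Definition relabel_action : {action 'S_n &-> vec R edge} :=
  TotalAction vec_relabel1 vec_relabelM.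

(* The characteristic vector of T is sent to that of the relabeled tree s T. *)
Lemma relabel_chi (T : {set edge}) (s : 'S_n) :
  relabel_action (chi T) s = chi [set edge_relabel s e | e in T]%SET.
Proof.
have K u : cancel (edge_relabel u) (edge_relabel u^-1%g).
  move=> e; apply: val_inj => /=; rewrite -imset_comp -[RHS]imset_id.
  by apply: eq_imset => v /=; rewrite permK.
apply/ffunP => e; rewrite !ffunE; congr ((_ : bool)%:R); apply/idP/imsetP.
  by move=> eT; exists (edge_relabel s^-1%g e) => //; rewrite -{1}[s]invgK K.
by move=> [f fT ->]; rewrite K.
Qed.

Definition xcs_P_ST : nat := xcs relabel_action P_ST.

End SpanningTreePolytope.

(* Main.v *)
Require Import Defs.
From mathcomp Require Import all_boot all_order all_algebra all_fingroup all_classical all_reals all_analysis.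
From HB Require Import structures.
From mathcomp Require Import zify ring lra.

(** Lower bound.  In a symmetric extension [Q] with fewer than C(n,3) facets, the
    stabilizer [H] of a facet has index less than C(n,3).  By Bochert's argument
    [H] contains a 3-cycle; the classes of the relation "[x] and [y] lie on a
    common 3-cycle of [H]" are permuted by [H], and counting their images shows
    that one class misses at most two points, so [H] contains the alternating
    group of the complement of a set [W] of two points.

    Take the tree made of a path 0-1-2-3-4-5 with all other vertices attached to
    0, lift its characteristic vector to [q] in [Q], fix a set [S] of three
    vertices, and combine the images of [q] under relabelings, giving weight +1
    to a relabeling that maps one of the six arcs {i, i+1, i+2} of Z/6 onto [S]
    and -1 to one that maps {0, 2, 4} or {1, 3, 5} onto [S].  This signed measure
    on triples has nonnegative marginals on all pairs, so every facet functional
    of [Q], depending only on the preimages of the two points of [W], is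
    nonnegative on the combination, which hence lies in [Q].  Its projection puts
    weight (2+2+2+2+1+1)/4 = 5/2 > 2 on the edges inside [S], which is impossible.

    Upper bound.  Martin's formulation orients a spanning tree towards every root
    [k]: z_kij >= 0, sum_j z_kij = 1 for i <> k, and z_kij + z_kji = x_ij.  A point
    of its projection outside the polytope is separated from all trees by some
    cost [c]; the greedy spanning tree for [c] contradicts this, because the total
    weight of any set of edges is at most the size of a spanning forest of it. *)

Set Implicit Arguments.
Unset Strict Implicit.
Unset Printing Implicit Defensive.

Import Order.TTheory GRing.Theory Num.Theory.
Import numFieldNormedType.Exports.

(** * Subgroups of small index in the symmetric group *)

(** Induction by Pascal's rule. The boundary case c + k = n + 1 is an equality by symmetry; once it
    is set aside, both Pascal terms fall under the induction hypothesis. *)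
Lemma leq_bin_mid n k c : k <= c -> c + k <= n -> 'C(n, k) <= 'C(n, c).
Proof.
elim: n k c => [|n IHn] k c kc cn.
  by have [-> ->] : k = 0 /\ c = 0 by lia.
have [->//|kc'] := eqVneq k c.
have [e|cn'] := eqVneq (c + k) n.+1.
  by have -> : c = n.+1 - k by [lia]; rewrite bin_sub //; lia.
case: k c kc cn kc' cn' => [|k] [|c] kc cn kc' cn'; try lia.
  by rewrite bin0 bin_gt0; lia.
by rewrite !binS leq_add // IHn //; lia.
Qed.

(** Excludes the second alternative of [bochert], where the index is at least m! for some m with n
    <= 2m. *)
Lemma leq_bin3_fact m : 7 <= m -> 'C(m.*2, 3) <= m`!.
Proof.
elim: m => // m IHm; rewrite leq_eqVlt => /predU1P[<-//|m7].
rewrite factS; apply: leq_trans (leq_mul (leqnn m.+1) (IHm m7)).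
have e k : 'C(k.+2, 3) * 6 = k.+2 * k.+1 * k.
  have -> : 6 = 3`! by []; rewrite bin_ffact !ffactnS ffactn0 /=; lia.
case: m m7 {IHm} => // m m7; have := e m.*2; have := e m.*2.+2; rewrite !doubleS.
move: ('C(_, _)) ('C(_, _)) => A B ? ?; nia.
Qed.

(** Serves the case of two blocks of size n/2. Passing through C(2c, 4) suffices because C(2c, 4) /
    C(2c, 3) = (2c - 3)/4 >= 2. *)
Lemma leq_bin_central c : 7 <= c -> 2 * 'C(c.*2, 3) <= 'C(c.*2, c).
Proof.
move=> c7; apply: leq_trans (leq_bin_mid (k := 4) _ _); try lia.
by have := mul_bin_left c.*2 3; nia.
Qed.

(* [c] is the size of a block, [t] the number of its images, and [a], [b] are
   the indices of the block stabilizer and of its intersection with a subgroup of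
   index [i]. *)
Lemma orbit_index_arith n c t i a b : 13 <= n -> 3 <= c -> 1 < t -> t * c <= n ->
    n < b + c.*2 -> 'C(n, 3) <= a -> 'C(n, c) <= a -> i * t = a * b ->
  i < 'C(n, 3) -> False.
Proof.
move=> n13 c3 t2 tc nb; have [n2c|n2c] := eqVneq n c.*2.
  have -> : t = 2 by nia.
  have /leq_bin_central : 7 <= c by lia.
  rewrite -n2c; have b0 : 0 < b by lia.
  move: 'C(n, 3) 'C(n, c) => A B; nia.
have tb : t <= b by nia.
move: 'C(n, 3) 'C(n, c) => A B; clear -t2 tb; nia.
Qed.
Section SmallIndexSubgroups.
Import mathcomp.boot.fintype mathcomp.boot.finset.
Local Open Scope group_scope.

Lemma commute_disjoint (T : finType) (s t : {perm T}) :
  (forall x, s x = x \/ t x = x) -> commute s t.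
Proof.
move=> st; apply/permP => x; rewrite !permM.
case: (st x) => [sx|tx].
  rewrite sx; case: (st (t x)) => [->//|/perm_inj ->].
  by rewrite sx.
rewrite tx; case: (st (s x)) => [/perm_inj sx|->//].
by rewrite sx tx.
Qed.

Section ThreeCycles.
Variable T : finType.
Implicit Types (x y z : T) (H : {group {perm T}}).

(** Permutations compose from left to right, so for distinct points this is the cycle x -> y -> z ->
    x. *)
Definition cyc3 x y z : {perm T} := tperm x y * tperm x z.

Lemma cyc3J x y z (s : {perm T}) : cyc3 x y z ^ s = cyc3 (s x) (s y) (s z).
Proof. by rewrite conjMg !tpermJ. Qed.

Lemma cyc3E x y z : y != x -> y != z -> x != z ->
  [/\ cyc3 x y z x = y, cyc3 x y z y = z & cyc3 x y z z = x].
Proof.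
move=> yx yz xz; rewrite /cyc3 !permM tpermL tpermR tpermL.
rewrite [tperm x z y]tpermD ?[tperm x y z]tpermD 1?eq_sym // ?tpermR //; last by rewrite eq_sym.
by rewrite eq_sym.
Qed.

Lemma cyc3D x y z w : w != x -> w != y -> w != z -> cyc3 x y z w = w.
Proof. by move=> wx wy wz; rewrite permM !tpermD // eq_sym. Qed.

Lemma cyc3_rot x y z : y != x -> y != z -> x != z -> cyc3 x y z = cyc3 y z x.
Proof.
move=> yx yz xz; have txz : tperm x z = tperm y z ^ tperm x y.
  by rewrite tpermJ tpermR tpermD // eq_sym.
by rewrite /cyc3 txz conjgE mulKVg [tperm y x]tpermC.
Qed.

Lemma cyc3V x y z : (cyc3 x y z)^-1 = cyc3 x z y.
Proof. by rewrite invMg !tpermV. Qed.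

Lemma tperm_mul_disjoint x y z w :
  tperm x y * tperm z w = cyc3 x y z * cyc3 z x w.
Proof. by rewrite /cyc3 [tperm z x]tpermC -!mulgA (mulgA (tperm x z)) tperm2 mul1g. Qed.

End ThreeCycles.

Section FullRelation.
Variables (T : finType) (H : {group {perm T}}).
Implicit Types (x y z : T).

Definition linked x y :=
  (x == y) || [exists z, [&& z != x, z != y & cyc3 x y z \in H]].

Lemma linkedP x y : reflect (x = y \/ exists z, [/\ x != y, z != x, z != y & cyc3 x y z \in H]) (linked x y).
Proof.
apply: (iffP orP) => [[/eqP|/existsP[z /and3P[zx zy c]]]|[->|[z [_ zx zy c]]]].
- by left.
- have [->|xy] := eqVneq x y; first by left.
  by right; exists z.
- by left.
- by right; apply/existsP; exists z; rewrite zx zy.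
Qed.

Lemma linked_refl x : linked x x.
Proof. by rewrite /linked eqxx. Qed.

Lemma linked_sym x y : linked x y = linked y x.
Proof.
suff aux u v : linked u v -> linked v u by apply/idP/idP; apply: aux.
case/linkedP => [->|[z [uv zu zv c]]]; first exact: linked_refl.
apply/linkedP; right; exists z; split=> //; first by rewrite eq_sym.
by rewrite -groupV cyc3V -cyc3_rot // eq_sym.
Qed.

Lemma linkedJ x y h : h \in H -> linked (h x) (h y) = linked x y.
Proof.
move=> hH; have aux u v g : g \in H -> linked u v -> linked (g u) (g v).
  move=> gH /linkedP[->|[z [uv zu zv c]]]; first exact: linked_refl.
  apply/linkedP; right; exists (g z).
  by rewrite !(inj_eq perm_inj) -cyc3J groupJ.
apply/idP/idP => [/(aux _ _ _ (groupVr hH))|]; last exact: aux.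
by rewrite !permK.
Qed.

(** A 3-cycle of [H] taking [y] to [z] fixes [x], unless [x] is its third point, and [linked] is
    invariant under [H]. In the exceptional case this 3-cycle itself links [x] and [z]. *)
Lemma linked_trans y x z : linked x y -> linked y z -> linked x z.
Proof.
move=> xy yz; case/linkedP: (yz) => [<-//|[w [yz' wy wz c]]].
have [->|xz] := eqVneq x z; first exact: linked_refl.
have [->|xy'] := eqVneq x y; first by [].
have [e y_ z_] := cyc3E (x := y) (y := z) (z := w) ltac:(by rewrite eq_sym) ltac:(by rewrite eq_sym) ltac:(by rewrite eq_sym).
have [xw|xw] := eqVneq x w.
  rewrite linked_sym; apply/linkedP; right; exists y; subst w.
  split; [by rewrite eq_sym | by [] | by rewrite eq_sym |].
  by rewrite -cyc3_rot // eq_sym.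
have := linkedJ x y c; rewrite e cyc3D // => ->.
exact: xy.
Qed.

(** Given (x y a) in [H], transitivity provides some (a z d) in [H]. Conjugating the first by the
    second replaces a by z and yields (x y z) when d is neither x nor y. If d = x, a further
    conjugation gives the inverse of (x y z); if d = y, conjugation by the inverse of (a z d)
    does. *)
Lemma linked_cyc3 x y z : x != y -> y != z -> x != z ->
  linked x y -> linked y z -> cyc3 x y z \in H.
Proof.
move=> xy yz xz /linkedP[/eqP|[a [_ ax ay c]]]; first by rewrite (negbTE xy).
move=> lyz; have [<-//|az] := eqVneq a z.
have lya : linked y a.
  apply/linkedP; right; exists x; split; [by rewrite eq_sym | by [] | by rewrite eq_sym |].
  by rewrite -cyc3_rot // eq_sym.
have laz : linked a z by apply: linked_trans lyz; rewrite linked_sym.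
have ne u v : u != v -> v != u :> T by rewrite eq_sym.
case/linkedP: laz => [/eqP|[d [_ da dz c']]]; first by rewrite (negbTE az).
have [ea ez ed] := cyc3E (ne _ _ az) (ne _ _ dz) (ne _ _ da).
have [fa fy fz] := cyc3E (ne _ _ ay) yz az.
have fx : cyc3 a y z x = x by rewrite cyc3D // ne.
have cJ := groupJ c c'; rewrite cyc3J ea in cJ.
have [dx|dx] := eqVneq d x.
  rewrite dx in c' cJ ed; rewrite ed cyc3D ?(ne _ _ ay) // 1?ne // in cJ.
  have := groupJ c cJ; rewrite cyc3J fa fy fx => cc.
  by rewrite -groupV cyc3V.
have [dy|dy] := eqVneq d y.
  rewrite dy in c' cJ ed; rewrite ed cyc3D // 1?ne // in cJ.
  have := groupJ c (groupVr c'); rewrite cyc3J cyc3V.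
  by rewrite fa fy fx => cc; rewrite -groupV cyc3V.
by rewrite !cyc3D // ne in cJ.
Qed.

(* A base-size argument: either a set of at least half of the points meets [H]
   trivially, or two elements of [H] have supports meeting in one point, and
   their commutator is a 3-cycle. *)
Lemma bochert :
  (exists x y z, [/\ x != y, y != z, x != z & cyc3 x y z \in H]) \/
  (exists2 m, #|T| <= m.*2 & m`! <= #|[set: {perm T}] : H|).
Proof.
pose triv (A : {set T}) := [forall h in H, perm_on A h ==> (h == 1)].
have triv0 : triv set0.
  apply/forall_inP => h hH; apply/implyP => h0; apply/eqP/permP => x.
  by rewrite perm1 (out_perm h0) // inE.
case: (@arg_maxnP _ set0 triv (fun A => #|A|) triv0) => A trivA maxA.
have [small|big] := ltnP #|A|.*2 #|T|; last first.
  right; exists #|A| => //; rewrite -card_perm.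
  (* Two permutations supported on [A] in the same coset of [H] differ by an element of [H]
     supported on [A], which is trivial; so the |A|! cosets are distinct. *)
  pose f (s : {perm T}) := H :* s.
  have /card_in_imset <- : {in perm_on A &, injective f}.
    move=> s t sA tA /rcoset_eqP/rcosetP[h hH st].
    have hE : h = s * t^-1 by rewrite st mulgK.
    have hA : perm_on A h by rewrite hE perm_onM // perm_onV.
    by have /forall_inP/(_ h hH)/implyP/(_ hA)/eqP h1 := trivA; rewrite st h1 mul1g.
  apply/subset_leq_card/subsetP => _ /imsetP[s _ ->].
  by apply/rcosetsP; exists s; rewrite ?inE.
left; have nt (B : {set T}) : #|A| < #|B| ->
    exists h, [/\ h \in H, perm_on B h & h != 1].
  move=> AB; have : ~~ triv B by apply: contraL AB => /maxA; rewrite -leqNgt.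
  rewrite negb_forall => /existsP[h]; rewrite !negb_imply => /and3P[hH hB h1].
  by exists h.
have [|h [hH hA h1]] := nt (~: A).
  by rewrite -(ltn_add2l #|A|) cardsC addnn.
have [a ha] : exists a, h a != a.
  apply/existsP; apply: contraR h1; rewrite negb_exists => /forallP h1.
  by apply/eqP/permP => x; rewrite perm1; apply/eqP; rewrite -[_ == _]negbK h1.
have aA : a \notin A.
  by apply: contra ha => aA; rewrite (out_perm hA) // inE aA.
have [|k [kH kA k1]] := nt (a |: A); first by rewrite cardsU1 aA.
have ka : k a != a.
  apply: contra k1 => /eqP ka; have /forall_inP/(_ k kH)/implyP := trivA; apply.
  apply/subsetP => x; rewrite inE => kx.
  have := subsetP kA x; rewrite !inE => /(_ kx)/orP[/eqP xa|//].
  by rewrite xa ka eqxx in kx.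
have hoff x : x \in A -> h x = x by move=> xA; rewrite (out_perm hA) // inE xA.
have koff x : x \notin A -> x != a -> k x = x.
  by move=> xA xa; rewrite (out_perm kA) // !inE negb_or xa.
have kaA : k a \in A.
  by have := perm_closed a kA; rewrite !inE eqxx (negbTE ka).
have haA : h a \notin A by apply: contra ha => /hoff/perm_inj ->.
(* [k * t] is supported on [A] and [h] off [A], so they commute and [h ^ k = h ^ t]. The commutator
   of [h] and [k] is then a product of two transpositions that share the point [k a]. *)
pose t := tperm a (k a).
have com : commute h (k * t).
  apply: commute_disjoint => x; have [xA|xA] := boolP (x \in A).
    by left; apply: hoff.
  right; rewrite permM; have [->|xa] := eqVneq x a; first by rewrite tpermR.
  rewrite koff // tpermD 1?eq_sym //; by apply: contraNneq xA => ->.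
have hk : h ^ k = h ^ t.
  by apply: (conjg_inj t); rewrite -!conjgM tperm2 conjg1 /conjg com mulKg.
exists (k a), (h a), a; split=> //.
- by apply: contraNneq haA => <-.
have -> : cyc3 (k a) (h a) a = h^-1 * h ^ k.
  rewrite hk conjgE tpermV !mulgA -[h^-1 * t * h]mulgA -conjgE tpermJ (hoff _ kaA).
  by congr (_ * _); apply: tpermC.
by rewrite groupM ?groupV // groupJ.
Qed.

End FullRelation.

(** [A] is carried to [B] by successively transposing a point of A - B with a point of B - A; both
    lie off [W] because [A] and [B] have the same trace on [W]. The predicate [Q] records whatever
    such transpositions preserve. *)
Lemma perm_transport (T : finType) (W A B : {set T}) (Q : {perm T} -> Prop) :
    Q 1 ->
    (forall x y s, x \notin W -> y \notin W -> Q s -> Q (tperm x y * s)) ->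
    #|A| = #|B| -> A :&: W = B :&: W ->
  exists2 s, Q s & [set s x | x in A] = B.
Proof.
move=> Q1 QM; have [m] := ubnP #|A :\: B|.
elim: m A => // m IHm A; rewrite ltnS => lem cAB AB.
have offW x C D : C :&: W = D :&: W -> x \in C :\: D -> x \notin W.
  move=> CD; rewrite inE => /andP[xD xC]; apply: contra xD => xW.
  by have := CD => /setP/(_ x); rewrite !inE xC xW /= andbT => <-.
have [/eqP e|[x xAB]] := set_0Vmem (A :\: B).
  exists 1 => //; have AsB : A \subset B by rewrite -setD_eq0.
  have -> : A = B by apply/eqP; rewrite eqEcard AsB cAB /=.
  by rewrite -[RHS]imset_id; apply: eq_imset => y; rewrite perm1.
have [y yBA] : exists y, y \in B :\: A.
  apply/set0Pn; rewrite -card_gt0 cardsD setIC -cAB -cardsD.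
  by apply/card_gt0P; exists x.
have xW := offW _ _ _ AB xAB; have yW := offW _ _ _ (esym AB) yBA.
move: (xAB) (yBA); rewrite !inE => /andP[xB xA] /andP[yA yB].
pose A' := [set tperm x y z | z in A].
have inA' z : (z \in A') = (tperm x y z \in A).
  by rewrite -{1}(tpermK x y z) mem_imset //; apply: perm_inj.
have [|||s Qs sA'] := IHm A'.
- apply: leq_trans lem; apply: proper_card; apply/properP; split.
    apply/subsetP => z; rewrite !inE inA'; case: tpermP => [->|->|_ _] //.
      by rewrite (negbTE yA) andbF.
    by rewrite yB.
  by exists x; rewrite // !inE inA' tpermL (negbTE yA) andbF.
- by rewrite card_imset //; apply: perm_inj.
- rewrite -AB; apply/setP => z; rewrite !inE inA'; case: tpermP => // ->.
    by rewrite (negbTE xW) !andbF.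
  by rewrite (negbTE yW) !andbF.
exists (tperm x y * s); first exact: QM.
by rewrite -sA' -imset_comp; apply: eq_imset => z; rewrite permM.
Qed.

(** Orbit-stabilizer: every set of the same size lies in the orbit of [C]. *)
Lemma card_orbit_sets (T : finType) (C : {set T}) :
  'C(#|T|, #|C|) <= #|[set: {perm T}] : 'N(C | 'P)|.
Proof.
rewrite -astab1_set -[in X in _ <= #|_ : X|](setTI 'C[C | _]) -card_orbit -card_draws.
apply/subset_leq_card/subsetP => B; rewrite inE => /eqP cB.
have [||||s _ sC] := @perm_transport T set0 C B (fun=> True) => //.
  by rewrite !setI0.
by apply/orbitP; exists s; rewrite ?inE //= setactE -sC; apply: eq_imset.
Qed.

(** Let [C] be a class with at least three points, missing at least three. Its images under [H] are
    disjoint blocks, and its stabilizer [N] in the symmetric group has index at least C(n, |C|) >=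
    C(n, 3). Comparing the index of [H] with that of [N] contradicts the small index of [H]. *)
Lemma large_linked_class (T : finType) (H : {group {perm T}}) :
    13 <= #|T| -> #|[set: {perm T}] : H| < 'C(#|T|, 3) ->
  exists x, #|T| <= #|[set y | linked H x y]|.+2.
Proof.
move=> T13 Hidx.
have [[x [y [z [xy yz xz c]]]]|[m Tm mle]] := bochert H; last first.
  have : 'C(#|T|, 3) <= m`!.
    apply: leq_trans (leq_bin2l 3 Tm) (leq_bin3_fact _); lia.
  by rewrite leqNgt (leq_ltn_trans mle).
exists x; set C := [set w | _]; set n := #|T| in T13 Hidx *.
have C3 : 3 <= #|C|.
  have <- : #|[set x; y; z]| = 3 by rewrite -setUA cardsU1 cards2 !inE negb_or xy xz yz.
  apply/subset_leq_card/subsetP => w; rewrite !inE -orbA.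
  have lxy : linked H x y by apply/linkedP; right; exists z; rewrite ![z == _]eq_sym.
  have c' : cyc3 y z x \in H by rewrite -cyc3_rot 1?eq_sym // eq_sym.
  have lyz : linked H y z by apply/linkedP; right; exists x.
  by case/or3P=> /eqP->; rewrite ?linked_refl // (linked_trans lxy).
rewrite leqNgt; apply/negP => Cn.
pose N := [group of 'N(C | 'P)].
pose O := orbit ('P^*) H C.
have imC h : h \in H -> 'P^* C h = [set w | linked H (h x) w].
  move=> hH; rewrite setactE; apply/setP => w; rewrite inE -{2}(permKV h w) linkedJ //.
  by rewrite -{1}(permKV h w) mem_imset ?inE //; apply: perm_inj.
have inO B : B \in O -> exists2 h, h \in H & B = [set w | linked H (h x) w].
  by case/orbitP=> h hH <-; exists h => //; apply: imC.
(* Both sides are the index of the intersection of [N] and [H], reached once through [H] and once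
   through [N]. *)
have Hidx2 : (#|[set: {perm T}] : H| * #|O| = #|[set: {perm T}] : N| * #|N : H|)%N.
  rewrite /O card_orbit astab1_set -[#|N : H|]indexgI [in RHS]setIC.
  rewrite (Lagrange_index (G := [set: {perm T}]%G)) ?subsetT ?subsetIl //.
  by rewrite (Lagrange_index (G := [set: {perm T}]%G)) ?subsetT ?subsetIr.
have cB B : B \in O -> #|B| = #|C|.
  by case/orbitP=> h _ <-; apply: card_setact.
have cardO : (#|O| * #|C| <= n)%N.
  rewrite -sum_nat_const -(eq_bigr _ cB).
  suff /eqP -> : trivIset O by apply: max_card.
  apply/trivIsetP => _ _ /inO[g gH ->] /inO[h hH ->].
  apply: contraNT => /pred0Pn[w /=].
  rewrite !inE => /andP[gw hw]; apply/eqP/setP => v; rewrite !inE.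
  have gh : linked H (g x) (h x) by apply: linked_trans gw _; rewrite linked_sym.
  by apply/idP/idP; apply: linked_trans; rewrite // linked_sym.
have CinO : C \in O by apply: orbit_refl.
have cN : 'C(n, #|C|) <= #|[set: {perm T}] : N| by apply: card_orbit_sets.
have c3 : 'C(n, 3) <= 'C(n, #|C|) by apply: leq_bin_mid => //; lia.
have [leO1|gtO1] := leqP #|O| 1.
  have card1O : #|O| = 1%N by apply/eqP; rewrite eqn_leq leO1; apply/card_gt0P; exists C.
  have := indexg_gt0 N H; move: Hidx2 Hidx c3 cN; rewrite card1O; clear; nia.
have [B /[dup]/inO[h hH hB] BO BC] : exists2 B, B \in O & B != C.
  move: gtO1; rewrite (cardsD1 C) CinO ltnS => /card_gt0P[B].
  by rewrite !inE => /andP[? ?]; exists B.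
have xh : ~~ linked H x (h x).
  apply: contra BC => xh; rewrite hB; apply/eqP/setP => v; rewrite !inE.
  by apply/idP/idP; apply: linked_trans; rewrite // linked_sym.
have [x' x'B x'h] : exists2 x', linked H (h x) x' & x' != h x.
  have : 1 < #|B| by rewrite cB // ltnW.
  rewrite (cardsD1 (h x)) hB inE linked_refl ltnS => /card_gt0P[w].
  by rewrite !inE => /andP[? ?]; exists w.
(* For y' in [D] the transposition of [h x] and y' preserves [C]; y' = [h x] gives the identity.
   These n - 2|C| + 1 elements of [N] lie in distinct cosets of [H]: otherwise [H] would contain a
   transposition breaking the link between [h x] and [x'], or a 3-cycle linking [h x] to a point
   outside its class. *)
pose D := ~: (C :|: (B :\ h x)).
have cD : n < #|D| + #|C|.*2.
  have cBh : #|B :\ h x|.+1 = #|C|.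
    by rewrite -(cB B) // [in RHS](cardsD1 (h x)) {2}hB inE linked_refl.
  have := cardsC (C :|: (B :\ h x)); have := cardsUI C (B :\ h x).
  by rewrite -/D -/n; move: cBh; clear; lia.
have inD y' : y' \in D -> y' != h x -> ~~ linked H (h x) y'.
  by rewrite !inE negb_or hB inE negb_and negbK => /andP[_ /orP[->|//]].
have ntp y' : y' \in D -> y' != h x -> tperm (h x) y' \notin H.
  move=> yD yh; have nl := inD y' yD yh; apply: contra nl => tH.
  have yx' : y' != x' by apply: contraNneq (inD y' yD yh) => ->.
  have := linkedJ (h x) x' tH; rewrite tpermL tpermD //; last by rewrite eq_sym.
  by rewrite x'B => yx; apply: linked_trans x'B _; rewrite linked_sym.
have DN : #|D| <= #|N : H|.
  have /card_in_imset <- : {in D &, injective (fun y' => H :* tperm (h x) y')}.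
    move=> y1 y2 y1D y2D /rcoset_eqP/rcosetP[g gH e].
    have {e gH} gH : tperm (h x) y1 * tperm (h x) y2 \in H.
      by rewrite e -mulgA tperm2 mulg1.
    have [y1h|y1h] := eqVneq y1 (h x).
      rewrite y1h tperm1 mul1g in gH; apply/eqP; rewrite y1h eq_sym.
      by apply: contraTT gH => y2h; apply: ntp.
    have [y2h|y2h] := eqVneq y2 (h x).
      by rewrite y2h tperm1 mulg1 in gH; have := ntp _ y1D y1h; rewrite gH.
    have [//|y12] := eqVneq y1 y2; case/negP: (inD y1 y1D y1h).
    by apply/linkedP; right; exists y2; split; rewrite // 1?eq_sym // eq_sym.
  apply/subset_leq_card/subsetP => _ /imsetP[y' y'D ->].
  apply/rcosetsP; exists (tperm (h x) y') => //.
  have offC w : ~~ linked H x w -> w \notin C by rewrite inE.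
  have hC : h x \notin C by apply: offC.
  have yC : y' \notin C by move: y'D; rewrite !inE negb_or => /andP[].
  apply/astabsP => w; rewrite /= /aperm; case: tpermP => // ->.
    by rewrite (negbTE hC) (negbTE yC).
  by rewrite (negbTE hC) (negbTE yC).
have dN : n < #|N : H| + #|C|.*2 by apply: leq_trans cD _; rewrite leq_add2r.
exact: orbit_index_arith T13 C3 gtO1 cardO dN (leq_trans c3 cN) cN Hidx2 Hidx.
Qed.

Lemma small_index_cyc3 (T : finType) (H : {group {perm T}}) :
    13 <= #|T| -> #|[set: {perm T}] : H| < 'C(#|T|, 3) ->
  exists W : {set T}, #|W| = 2 /\ forall x y z, x \notin W -> y \notin W ->
    z \notin W -> x != y -> y != z -> x != z -> cyc3 x y z \in H.
Proof.
move=> T13 Hidx; have [x0] := large_linked_class T13 Hidx.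
set C := [set y | _] => Cbig.
have inC x y : x \in C -> y \in C -> linked H x y.
  by rewrite !inE => x0x; apply: linked_trans; rewrite linked_sym.
have cC : #|~: C| <= 2 by have := cardsC C; lia.
(* The complement of the class has at most two points; it is padded to exactly two. *)
have [W [cW CW]] : exists W : {set T}, #|W| = 2 /\ ~: C \subset W.
  have [m] := ubnP (2 - #|~: C|); elim: m (~: C) cC => // m IHm A A2 mA.
  have [A2'|A2'] := eqVneq #|A| 2; first by exists A.
  have /card_gt0P[a] : 0 < #|~: A| by have := cardsC A; lia.
  rewrite inE => aA; have [||W [cW AW]] := IHm (a |: A); rewrite ?cardsU1 ?aA; try lia.
  by exists W; split=> //; apply: subset_trans AW; apply: subsetUr.
exists W; split=> // x y z xW yW zW xy yz xz.
have offW v : v \notin W -> v \in C.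
  by apply: contraR => vC; apply: (subsetP CW); rewrite inE.
by apply: linked_cyc3 => //; apply: inC; apply: offW.
Qed.

End SmallIndexSubgroups.

Local Open Scope ring_scope.

(** * Trees and signed sums *)

Section ParentTrees.
Import mathcomp.boot.fintype mathcomp.boot.finset.
Variables (n : nat) (par : 'I_n -> 'I_n).
Hypothesis par_lt : forall v : 'I_n, val v != 0%N -> (par v < v)%N.

Definition parent_tree : {set edge n} :=
  [set e | [exists v : 'I_n, (val v != 0%N) && (val e == [set v; par v])]].

Lemma par_neq (v : 'I_n) : val v != 0%N -> v != par v.
Proof. by move=> /par_lt; apply: contraTneq => <-; rewrite ltnn. Qed.

Lemma adj_parent_tree u v : adj parent_tree u v ->
  ((val u != 0%N) && (v == par u)) || ((val v != 0%N) && (u == par v)).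
Proof.
move=> /exists_inP[e]; rewrite inE => /existsP[w /andP[w0 /eqP ->]] /eqP e_uv.
have uv : u \in [set w; par w] by rewrite e_uv !inE eqxx.
have wv : w \in [set u; v] by rewrite -e_uv !inE eqxx.
have pv : par w \in [set u; v] by rewrite -e_uv !inE eqxx orbT.
move: uv wv pv; rewrite !inE; have [->|uw] := eqVneq u w.
  by rewrite w0 [par w == w]eq_sym (negbTE (par_neq w0)) /= => _ _ /eqP ->; rewrite eqxx.
by move=> /= /eqP upw /eqP <- _; rewrite w0 -upw eqxx orbT.
Qed.

Lemma parent_adj (v : 'I_n) : val v != 0%N -> adj parent_tree v (par v).
Proof.
move=> v0; have c2 : #|[set v; par v]| == 2%N by rewrite cards2 par_neq.
apply/exists_inP; exists (exist _ [set v; par v] c2) => //.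
by rewrite inE; apply/existsP; exists v; rewrite v0 /=.
Qed.

Lemma adj_sym (T : {set edge n}) : symmetric (adj T).
Proof. by move=> u v; rewrite /adj setUC. Qed.

(** Labels decrease towards the parent, so every vertex reaches 0. On a cycle, both neighbours of
    the vertex of largest label would be its parent. *)
Lemma parent_tree_spanning : (0 < n)%N -> spanning_tree parent_tree.
Proof.
move=> n0; have csym : connect_sym (adj parent_tree).
  exact/sym_connect_sym/adj_sym.
split.
  have root u : connect (adj parent_tree) u (Ordinal n0).
    have [m] := ubnP (val u); elim: m u => // m IHm u; rewrite ltnS => um.
    have [u0|u0] := eqVneq (val u) 0%N; first by rewrite (_ : u = Ordinal n0) //; apply: val_inj.
    apply: connect_trans (connect1 (parent_adj u0)) (IHm _ _).
    exact: leq_trans (par_lt u0) um.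
  by move=> u v; apply: connect_trans (root u) _; rewrite csym.
move=> c c2 /andP[cyc uniqc].
have [x xc] : exists x, x \in c by case: c c2 {cyc uniqc} => // x; exists x; rewrite inE eqxx.
case: (@arg_maxnP _ x (fun y => y \in c) (fun y => val y) xc) => m mc mmax.
have [i c' cE] := rot_to mc.
move: cyc uniqc; rewrite -(rot_cycle i) -(rot_uniq i) cE.
have sz : (1 < size c')%N by have := congr1 size cE; rewrite size_rot /=; lia.
have {cE} cE y : y \in c' -> (y <= m)%N.
  by move=> yc'; apply: mmax; rewrite -(mem_rot i) cE inE yc' orbT.
have up y : y \in c' -> y != m -> adj parent_tree m y || adj parent_tree y m -> y = par m.
  move=> yc' ym; rewrite [adj _ y m]adj_sym orbb => /adj_parent_tree.
  case/orP => /andP[y0 /eqP//] my; have := par_lt y0.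
  by rewrite -my ltnNge cE.
case: c' sz cE up => [|a [|b c']] //= _ cE up /and3P[ma _].
rewrite rcons_path => /andP[_ zm] /andP[mc' /andP[ac' _]].
have zin : last b c' \in b :: c' by apply: mem_last.
have zm' : last b c' != m.
  by apply: contraNneq mc' => <-; rewrite inE zin orbT.
have am : a != m by apply: contraNneq mc' => ->; rewrite inE eqxx.
have az : a = last b c'.
  rewrite (up a) ?inE ?eqxx ?ma // [RHS]up ?zm ?orbT //.
  by rewrite inE zin orbT.
by rewrite az zin in ac'.
Qed.

Lemma parent_edge_inj (v w : 'I_n) : val v != 0%N -> val w != 0%N ->
  [set v; par v] = [set w; par w] -> v = w.
Proof.
move=> v0 w0 e; have vw : v \in [set w; par w] by rewrite -e !inE eqxx.
have wv : w \in [set v; par v] by rewrite e !inE eqxx.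
move: vw wv; rewrite !inE => /orP[/eqP//|/eqP vpw] /orP[/eqP//|/eqP wpv].
by have := par_lt v0; have := par_lt w0; rewrite -vpw -wpv; lia.
Qed.

(** Each tree edge is counted at its child endpoint, so edge counts become computations on
    vertices. *)
Lemma card_parent_edges (A : {set 'I_n}) :
  #|[set e in parent_tree | val e \subset A]| =
  #|[set v : 'I_n | [&& val v != 0%N, v \in A & par v \in A]]|.
Proof.
rewrite -(card_imset _ val_inj) -[RHS](card_in_imset (f := fun v => [set v; par v])).
  congr #|pred_of_set _|; apply/setP => B; apply/imsetP/imsetP.
    move=> [e]; rewrite !inE => /andP[/existsP[v /andP[v0 /eqP ev]] eA] ->.
    exists v; rewrite ?ev // inE v0; rewrite ev in eA.
    by rewrite !(fintype.subsetP eA) // !inE eqxx ?orbT.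
  move=> [v]; rewrite inE => /and3P[v0 vA pA] ->.
  have c2 : #|[set v; par v]| == 2%N by rewrite cards2 par_neq.
  exists (exist _ [set v; par v] c2) => //; rewrite !inE /=; apply/andP; split.
    by apply/existsP; exists v; rewrite v0 /=.
  by apply/fintype.subsetP => x; rewrite !inE => /orP[] /eqP->.
by move=> v w; rewrite !inE => /and3P[v0 _ _] /and3P[w0 _ _]; apply: parent_edge_inj.
Qed.

Lemma parent_tree_relabel (s : 'S_n) (e : edge n) :
    (forall v, (val (s v) == 0%N) = (val v == 0%N)) ->
    (forall v : 'I_n, val v != 0%N -> par (s v) = s (par v)) ->
  (edge_relabel s e \in parent_tree) = (e \in parent_tree).
Proof.
move=> s0 spar; rewrite !inE; apply/existsP/existsP => -[v /andP[v0 /eqP ev]].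
  exists (s^-1%g v); rewrite -s0 permKV v0 /=; apply/eqP/(imset_inj (@perm_inj _ s)).
  rewrite /= in ev; rewrite ev imsetU1 imset_set1 permKV -spar ?permKV //.
  by rewrite -s0 permKV.
by exists (s v); rewrite s0 v0 /= ev imsetU1 imset_set1 spar.
Qed.

End ParentTrees.

Section Patterns.
Import mathcomp.boot.fintype mathcomp.boot.finset.

(* With weight 1 on [arcs] and -1 on [odd_even], every pair of consecutive points
   of Z/6 is covered twice and all other pairs are covered with total weight 0. *)
Definition arcs : seq (seq nat) :=
  [:: [:: 0; 1; 2]; [:: 1; 2; 3]; [:: 2; 3; 4]; [:: 3; 4; 5]; [:: 4; 5; 0];
      [:: 5; 0; 1]]%N.

Definition odd_even : seq (seq nat) := [:: [:: 0; 2; 4]; [:: 1; 3; 5]]%N.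

(** Nonnegativity of the signed measure on patterns once the membership of two points is prescribed.
    Numbers above 5 lie in no pattern, which leaves a finite check. *)
Lemma pair_marginals (a b : nat) (x y : bool) :
  let P (l : seq nat) := ((a \in l) == x) && ((b \in l) == y) in
  (count P odd_even <= count P arcs)%N.
Proof.
by case: a => [|[|[|[|[|[|a]]]]]]; case: b => [|[|[|[|[|[|b]]]]]]; case: x; case: y.
Qed.

Variable n : nat.

Definition points (l : seq nat) : {set 'I_n} := [set v : 'I_n | val v \in l].

Lemma card_small_ord (P : pred nat) m : (m <= n)%N ->
  (forall i, P i -> (i < m)%N) -> #|[set v : 'I_n | P v]| = count P (iota 0 m).
Proof.
move=> mn Pm; rewrite -sum1_card (eq_bigl (fun v : 'I_n => P v)); last by move=> v; rewrite inE.
rewrite -(big_mkord P (fun=> 1%N)) (@big_cat_nat _ _ _ m) //= [X in (_ + X)%N]big_seq_cond.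
rewrite [X in (_ + X)%N]big1 ?addn0 ?sum1_count /index_iota ?subn0 //.
by move=> i; rewrite mem_index_iota => /andP[/andP[mi _] /Pm]; rewrite ltnNge mi.
Qed.

Hypothesis n13 : (13 <= n)%N.

Lemma card_points l : l \in arcs ++ odd_even -> #|points l| = 3.
Proof.
move=> la; rewrite /points (@card_small_ord (mem l) 6); last 2 first.
- by lia.
- move=> i; have : all (fun l => all (fun i => i < 6)%N l) (arcs ++ odd_even) by [].
  by move/allP/(_ l la)/allP; apply.
have : all (fun l : seq nat => count (mem l) (iota 0 6) == 3) (arcs ++ odd_even) by [].
by move/allP/(_ l la)/eqP.
Qed.

Definition path_parent (v : nat) : nat := if (v <= 5)%N then v.-1 else 0%N.

Lemma path_parent_le (v : 'I_n) : (path_parent v < n)%N.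
Proof.
apply: leq_ltn_trans (ltn_ord v); rewrite /path_parent.
by case: ifP => // _; apply: leq_pred.
Qed.

Definition opar (v : 'I_n) : 'I_n := Ordinal (path_parent_le v).

Lemma opar_lt (v : 'I_n) : val v != 0%N -> (opar v < v)%N.
Proof. by rewrite /= /path_parent; case: ifP; lia. Qed.

(* The many leaves at 0 are twins: transposing two of them fixes the tree, which
   makes up for the odd permutations missing from the facet stabilizers. *)
Definition broom : {set edge n} := parent_tree opar.

Lemma broom_spanning : spanning_tree broom.
Proof. by apply: parent_tree_spanning opar_lt _; lia. Qed.

Lemma broom_tperm (a b : 'I_n) (e : edge n) : (6 <= a)%N -> (6 <= b)%N ->
  (edge_relabel (tperm a b) e \in broom) = (e \in broom).
Proof.
move=> a6 b6; have par0 (v : 'I_n) : (6 <= v)%N -> path_parent v = 0%N.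
  by rewrite /path_parent; case: ifP => //; lia.
have nz (v : 'I_n) : (6 <= v)%N -> (val v == 0%N) = false by case: v => -[].
apply: parent_tree_relabel => [v|v v0]; first by case: tpermP => // ->; rewrite !nz.
have pv : (opar v <= 4)%N.
  by have := path_parent_le v; rewrite /= /path_parent; case: ifP; lia.
rewrite [RHS]tpermD; last 2 first.
- by apply/eqP => ap; move: a6; rewrite ap leqNgt (leq_ltn_trans pv).
- by apply/eqP => bp; move: b6; rewrite bp leqNgt (leq_ltn_trans pv).
by apply: val_inj; case: tpermP => //= ->; rewrite !par0.
Qed.

Definition broom_edges_in (l : seq nat) : nat :=
  count (fun v => [&& v != 0, v \in l & path_parent v \in l])%N (iota 0 6).

Lemma card_broom_edges l : l \in arcs ++ odd_even ->
  #|[set e in broom | val e \subset points l]| = broom_edges_in l.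
Proof.
move=> la; rewrite card_parent_edges; last exact: opar_lt.
rewrite /broom_edges_in -(@card_small_ord _ 6) //; last 2 first.
- by lia.
- move=> i /and3P[_ il _].
  have : all (fun l => all (fun i => i < 6)%N l) (arcs ++ odd_even) by [].
  by move/allP/(_ l la)/allP; apply.
by apply: eq_card => v; rewrite !inE.
Qed.

Section SignedSums.
Variables (R : realType).

Definition signed_sum (F : seq nat -> R) : R :=
  \sum_(l <- arcs) F l - \sum_(l <- odd_even) F l.

Lemma eq_signed_sum F1 F2 :
  {in arcs ++ odd_even, F1 =1 F2} -> signed_sum F1 = signed_sum F2.
Proof.
move=> F12; rewrite /signed_sum; congr (_ - _); apply: eq_big_seq => l la;
  by apply: F12; rewrite mem_cat la ?orbT.
Qed.

Lemma signed_sumZ c F : signed_sum (fun l => c * F l) = c * signed_sum F.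
Proof. by rewrite /signed_sum -!mulr_sumr mulrBr. Qed.

Lemma signed_sum_exchange (J : finType) (P : pred J) (F : J -> seq nat -> R) :
  \sum_(j | P j) signed_sum (F j) = signed_sum (fun l => \sum_(j | P j) F j l).
Proof. by rewrite /signed_sum sumrB exchange_big /= [X in _ - X]exchange_big. Qed.

Lemma signed_sum_pair_ge0 (a b : nat) (x y : bool) :
  0 <= signed_sum (fun l => (((a \in l) == x) && ((b \in l) == y))%:R).
Proof.
have cnt (P : pred (seq nat)) s : \sum_(l <- s) (P l)%:R = (count P s)%:R :> R.
  by elim: s => [|l s IHs]; rewrite ?big_nil // big_cons IHs natrD.
by rewrite /signed_sum subr_ge0 !cnt ler_nat; apply: pair_marginals.
Qed.

End SignedSums.
End Patterns.

(** * Positivity of the signed sums for invariant functions *)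

Section InvariantSums.
Import mathcomp.boot.fintype mathcomp.boot.finset.
Variables (R : realType) (n : nat) (f : 'S_n -> R) (W : {set 'I_n}).
Hypothesis n13 : (13 <= n)%N.

Definition hits (S : {set 'I_n}) (s : 'S_n) (l : seq nat) : R :=
  ([set s v | v in points n l] == S)%:R.

Lemma sum_hits_eq (S : {set 'I_n}) l1 l2 :
    #|points n l1| = #|points n l2| ->
  \sum_s hits S s l1 = \sum_s hits S s l2.
Proof.
move=> cl; have [t _ tl] : exists2 t : 'S_n, True & [set t x | x in points n l2] = points n l1.
  by apply: (@perm_transport _ set0) => //; rewrite !setI0.
rewrite [RHS](reindex_inj (mulgI t)) /=; apply: eq_bigr => s _.
rewrite /hits -tl -imset_comp; congr ((_ == _)%:R).
by apply: eq_imset => v; rewrite permM.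
Qed.

Hypothesis cW : #|W| = 2%N.
Hypothesis f_cyc3 : forall s x y z, x \notin W -> y \notin W -> z \notin W ->
  x != y -> y != z -> x != z -> f (s * cyc3 x y z)%g = f s.
Hypothesis f_leaf : forall (s : 'S_n) (a b : 'I_n), (6 <= a)%N -> (6 <= b)%N ->
  f (tperm a b * s)%g = f s.

(* Multiplying by a transposition of two leaves avoiding [W], [x] and [y] turns
   [tperm x y] into a product of two 3-cycles. *)
Lemma f_tperm s x y : x \notin W -> y \notin W -> f (s * tperm x y)%g = f s.
Proof.
move=> xW yW; have [->|xy] := eqVneq x y; first by rewrite tperm1 mulg1.
pose leaves := [set v : 'I_n | (6 <= v)%N].
(* There are n - 6 >= 7 images of leaves and at most four points to avoid, so two suitable images
   remain. *)
pose L := [set s v | v in leaves] :\: (W :|: [set x; y]).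
have /card_gt1P[u [v [uL vL uv]]] : (1 < #|L|)%N.
  have cL : #|[set s v | v in leaves]| = (n - 6)%N.
    rewrite card_imset; last exact: perm_inj.
    have := cardsC leaves; rewrite card_ord => cn.
    have cC : #|~: leaves| = 6.
      rewrite (_ : ~: _ = [set v : 'I_n | (v < 6)%N]); last first.
        by apply/setP => v; rewrite !inE -ltnNge.
      by rewrite (@card_small_ord _ (fun i => i < 6)%N 6) //; lia.
    by rewrite -[in RHS]cn cC addnK.
  have cB : (#|W :|: [set x; y]| <= 4)%N.
    by apply: leq_trans (leq_card_setU _ _) _; rewrite cW cards2 xy.
  rewrite /L cardsD cL.
  by apply: leq_trans (leq_sub2l _ (leq_trans (subset_leq_card (subsetIr _ _)) cB)); lia.
have inL w : w \in L -> exists2 a : 'I_n, (6 <= a)%N & [/\ w = s a, w \notin W, w != x & w != y].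
  rewrite !inE !negb_or => /andP[/and3P[wW wx wy] /imsetP[a]].
  by rewrite inE => a6 wE; exists a.
have [a a6 [uE uW ux uy]] := inL u uL; have [b b6 [vE vW vx vy]] := inL v vL.
(* A transposition of images of leaves, applied after [t], equals the transposition of these leaves
   applied before [t]. *)
have sab (t : 'S_n) : t a = u -> t b = v -> f (t * tperm u v)%g = f t.
  by move=> ta tb; rewrite -ta -tb -tpermJ -conjgC f_leaf.
have st : f (s * tperm x y * tperm u v)%g = f (s * tperm x y)%g.
  by apply: sab; rewrite permM -?uE -?vE tpermD // eq_sym.
rewrite -st -mulgA (tperm_mul_disjoint x y u v) mulgA !f_cyc3 //.
- by rewrite eq_sym.
- by rewrite eq_sym.
- by rewrite eq_sym.
Qed.

(** By [f_tperm] the sum depends on [S] only through its trace on [W], so it may be summed over all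
    triples [B] with that trace. For fixed [s] this collects the patterns whose membership at the
    preimages of the two points of [W] is prescribed, which is a pair marginal. *)
Lemma invariant_signed_sum_ge0 (S : {set 'I_n}) : (forall s, 0 <= f s) -> #|S| = 3%N ->
  0 <= \sum_s f s * signed_sum (hits S s).
Proof.
move=> f0 cS; pose D B := \sum_s f s * signed_sum (hits B s).
pose BB := [set B : {set 'I_n} | (#|B| == 3%N) && (B :&: W == S :&: W)].
have DB B : B \in BB -> D B = D S.
  rewrite inE => /andP[/eqP cB /eqP BW].
  have [||||t ft tB] := @perm_transport _ W B S (fun t => forall s, f (s * t)%g = f s).
  - by move=> s; rewrite mulg1.
  - by move=> x y t xW yW ft s; rewrite mulgA ft f_tperm.
  - by rewrite cB cS.
  - by [].
  rewrite /D [RHS](reindex_inj (mulIg t)) /=; apply: eq_bigr => s _.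
  rewrite ft; congr (_ * _); apply: eq_signed_sum => l _; rewrite /hits -tB.
  have -> : [set (s * t)%g v | v in points n l] = [set t w | w in [set s v | v in points n l]].
    by rewrite -imset_comp; apply: eq_imset => v; rewrite permM.
  by rewrite (inj_eq (imset_inj (@perm_inj _ t))).
have SBB : S \in BB by rewrite inE cS !eqxx.
suff : 0 <= \sum_(B in BB) D B.
  rewrite (eq_bigr _ DB) sumr_const -mulr_natl pmulr_rge0 // ltr0n.
  by apply/card_gt0P; exists S.
rewrite /D exchange_big /=; apply: sumr_ge0 => s _.
rewrite -mulr_sumr mulr_ge0 // signed_sum_exchange.
have /cards2P[u [v [_ WE]]] := introT eqP cW.
apply: le_trans (signed_sum_pair_ge0 R (s^-1%g u) (s^-1%g v) (u \in S) (v \in S)) _.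
rewrite le_eqVlt; apply/orP; left; apply/eqP/eq_signed_sum => l la.
have sl w : (w \in [set s v | v in points n l]) = (val (s^-1%g w) \in l).
  by rewrite -{1}(permKV s w) mem_imset ?inE //; apply: perm_inj.
set X := [set s v | v in points n l].
have XBB : (X \in BB) = ((val (s^-1%g u) \in l) == (u \in S)) && ((val (s^-1%g v) \in l) == (v \in S)).
  rewrite inE card_imset; last exact: perm_inj.
  rewrite card_points // eqxx /= -!sl WE; apply/eqP/andP => [e|[/eqP eu /eqP ev]].
    have /setP/(_ u) := e; have /setP/(_ v) := e.
    by rewrite !inE !eqxx ?orbT !andbT => -> ->.
  apply/setP => w; rewrite !inE; case: eqVneq => [->|_]; first by rewrite eu.
  by case: eqVneq => [->|_]; rewrite ?ev // !andbF.
rewrite -XBB /hits -/X; case: (boolP (X \in BB)) => XB.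
  rewrite (bigD1 X) //= eqxx big1 ?addr0 // => B /andP[_ BX].
  by rewrite eq_sym (negbTE BX).
rewrite big1 // => B BB'; case: eqVneq => // e; by rewrite e BB' in XB.
Qed.

End InvariantSums.

(** * Orientations of trees and greedy spanning trees *)

Lemma connect_ind (V : finType) (e : rel V) (P : V -> Prop) x y :
  P x -> (forall u v, connect e x u -> P u -> e u v -> P v) -> connect e x y -> P y.
Proof.
move=> Px Pe /connectP[p]; elim/last_ind: p y => [|p z IHp] y /=; first by move=> _ ->.
rewrite rcons_path last_rcons => /andP[ep ez] ->.
by apply: (Pe (last x p)) => //; [apply/connectP; exists p|apply: IHp].
Qed.

Section TreeOrientation.
Import mathcomp.boot.fintype mathcomp.boot.finset.
Variables (n : nat) (T : {set edge n}).
Implicit Types (i j k u v : 'I_n).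

Lemma adj_neq i j : adj T i j -> i != j.
Proof.
move=> /exists_inP[e _ /eqP eE]; apply/eqP => ij; have := valP e.
by rewrite /= eE ij setUid cards1.
Qed.

Lemma adj_edge (e : edge n) i j : val e = [set i; j] -> adj T i j = (e \in T).
Proof.
move=> eE; apply/exists_inP/idP => [[f fT /eqP fE]|eT]; last by exists e; rewrite ?eE.
by rewrite (_ : e = f) //; apply: val_inj; rewrite /= eE fE.
Qed.

Definition adj_minus i j : rel 'I_n :=
  fun u v => adj T u v && ([set u; v] != [set i; j]).

Lemma adj_minus_sym i j : connect_sym (adj_minus i j).
Proof.
by apply: sym_connect_sym => u v; rewrite /adj_minus adj_sym [[set u; v]]setUC.
Qed.

Lemma adj_minusC i j : adj_minus i j =2 adj_minus j i.
Proof. by move=> u v; rewrite /adj_minus [[set i; j]]setUC. Qed.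

Hypothesis Ttree : spanning_tree T.

(** A simple path from [i] to [j] that avoids the edge has at least three vertices, and the edge
    closes it to a cycle. *)
Lemma tree_bridge i j : adj T i j -> ~~ connect (adj_minus i j) i j.
Proof.
move=> ij; apply/negP => /connectP[p0 /shortenP[p pp up _] jE].
have [_ acyc] := Ttree; apply: (acyc (i :: p)).
  case: p pp up jE => [|a [|b p]] //= pp up jE.
    by have := adj_neq ij; rewrite jE eqxx.
  by move: pp; rewrite /adj_minus jE eqxx andbF.
rewrite /ucycle up andbT /= rcons_path -jE adj_sym ij andbT.
by apply: sub_path pp => u v /andP[].
Qed.

(** Along a path of the tree from [k], the first use of the edge starts at [i] or [j], reached
    without it. *)
Lemma tree_split i j k : connect (adj_minus i j) k i \/ connect (adj_minus i j) k j.
Proof.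
have [con _] := Ttree; apply: contrapT => /not_orP[ki kj].
apply: (ki); apply: (connect_ind (P := fun x => connect (adj_minus i j) k x)) (con k i).
  exact: connect0.
move=> u v _ ku uv; apply: (connect_trans ku (connect1 _)).
rewrite /adj_minus uv /=; apply/eqP => e.
have : u \in [set i; j] by rewrite -e !inE eqxx.
by rewrite !inE => /orP[]/eqP ue; move: ku; rewrite ue.
Qed.

(* Whether the edge [ij] leads from [i] towards the root [k]. *)
Definition towards k i j : bool := adj T i j && ~~ connect (adj_minus i j) k i.

Lemma towards_root k j : towards k k j = false.
Proof. by rewrite /towards connect0 andbF. Qed.

Lemma towards_diag k i : towards k i i = false.
Proof. by apply/negP => /andP[/adj_neq]; rewrite eqxx. Qed.

(** Deleting an edge of the tree leaves [k] on exactly one of its two sides. *)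
Lemma towardsC k i j : (towards k i j + towards k j i)%N = adj T i j.
Proof.
rewrite /towards [adj T j i]adj_sym (eq_connect (adj_minusC j i)).
case: (boolP (adj T i j)) => //= ij.
have := tree_bridge ij; have := tree_split i j k.
case: (boolP (connect _ k i)) => ki; case: (boolP (connect _ k j)) => kj //=.
  by rewrite (connect_trans _ kj) // adj_minus_sym.
by case.
Qed.

Lemma towards_exists k i : i != k -> exists j, towards k i j.
Proof.
(* [e] is adjacency with the vertex [i] deleted; the required [j] is a neighbour of [i] reached from
   [k] without passing through [i]. *)
move=> ik; pose e := [rel u v | [&& adj T u v, u != i & v != i]].
have [con _] := Ttree.
have [j kj ji] : exists2 j, connect e k j & adj T j i.
  apply: contrapT => none.
  suff [] : connect e k i /\ i != i by rewrite eqxx.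
  apply: (connect_ind (P := fun x => connect e k x /\ x != i)) (con k i).
    by rewrite connect0 eq_sym.
  move=> u v _ [ku ui] uv; have [vi|vi] := eqVneq v i.
    by case: none; exists u; rewrite // -vi.
  by split=> //; apply: (connect_trans ku (connect1 _)); rewrite /= uv ui vi.
exists j; rewrite /towards adj_sym ji /=; apply/negP => ki.
have /negP := tree_bridge ji; apply; rewrite (eq_connect (adj_minusC j i)).
rewrite adj_minus_sym; apply: connect_trans (_ : connect _ k j).
  by rewrite adj_minus_sym.
apply: connect_sub kj => u v /and3P[uv ui vi]; apply: connect1.
rewrite /adj_minus uv /=; apply/eqP => e1.
have : i \in [set u; v] by rewrite e1 !inE eqxx.
by rewrite !inE ![i == _]eq_sym (negbTE ui) (negbTE vi).
Qed.

(** A path from [k] to [j] avoiding the edge ij never meets [i], hence also avoids ij'. If j'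
    differs from j, extending the path by the step from [j] to [i] reaches [i] without ij'. *)
Lemma towards_uniq k i j j' : towards k i j -> towards k i j' -> j = j'.
Proof.
move=> /andP[ij nki] /andP[ij' nki']; apply/eqP/negPn/negP => jj'.
have kj : connect (adj_minus i j) k j.
  by case: (tree_split i j k) => // ki; rewrite ki in nki.
case/negP: nki'; apply: connect_trans (connect1 (_ : adj_minus i j' j i)); last first.
  rewrite /adj_minus adj_sym ij /=; apply/eqP => e.
  have : j \in [set i; j'] by rewrite -e !inE eqxx.
  by rewrite !inE (negbTE jj') orbF eq_sym (negbTE (adj_neq ij)).
apply: (connect_ind (P := fun x => connect (adj_minus i j') k x)) kj; first exact: connect0.
move=> u v ku ku' uv; apply: (connect_trans ku' (connect1 _)).
have kv := connect_trans ku (connect1 uv).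
case/andP: uv => uv _; rewrite /adj_minus uv /=; apply/eqP => e.
have : i \in [set u; v] by rewrite e !inE eqxx.
have nu : u != i by apply/eqP => ui; move: nki; rewrite -{2}ui ku.
have nv : v != i by apply/eqP => vi; move: nki; rewrite -{2}vi kv.
by rewrite !inE ![i == _]eq_sym (negbTE nu) (negbTE nv).
Qed.

Lemma sum_towards (R : realType) k i : i != k ->
  \sum_j (towards k i j)%:R = 1 :> R.
Proof.
move=> /towards_exists[j ij]; rewrite (bigD1 j) //= ij big1 ?addr0 // => j' jj'.
by case: (boolP (towards k i j')) => // /(towards_uniq ij) e; rewrite e eqxx in jj'.
Qed.

End TreeOrientation.

Section Martin.
Import mathcomp.boot.fintype mathcomp.boot.finset.
Variables (R : realType) (n : nat).
Implicit Types (e : edge n) (z : 'I_n -> 'I_n -> 'I_n -> R).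

(* [z k i j] is the weight of the arc from [i] to [j] when edges are oriented
   towards the root [k]. *)
Definition martin z : Prop :=
  [/\ forall k i j, 0 <= z k i j, forall k j, z k k j = 0, forall k i, z k i i = 0,
      forall k i, i != k -> \sum_j z k i j = 1
    & forall k l i j, z k i j + z k j i = z l i j + z l j i].

Definition ends_of e : pred ('I_n * 'I_n) := fun a => [set a.1; a.2] == val e.

(** Under [martin] the inner sum is the same for every root [k]. Averaging over all roots makes the
    projection commute with relabelings for arbitrary [z]. *)
Definition edge_weight z e : R := n%:R^-1 * \sum_k \sum_(a | ends_of e a) z k a.1 a.2.

Lemma edge_ends e : exists u v, u != v /\ val e = [set u; v].
Proof. by have /cards2P[u [v [uv eE]]] := valP e; exists u, v. Qed.

Lemma sum_ends e u v (f : 'I_n * 'I_n -> R) : u != v -> val e = [set u; v] ->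
  \sum_(a | ends_of e a) f a = f (u, v) + f (v, u).
Proof.
move=> uv eE; rewrite (bigD1 (u, v)) /=; last by rewrite /ends_of eE.
rewrite (bigD1 (v, u)) /=; last first.
  by rewrite /ends_of eE setUC eqxx /= xpair_eqE negb_and eq_sym uv.
rewrite big1 ?addr0 // => -[a b] /andP[/andP[/eqP/esym ab ab1] ab2].
have {}ab : val e = [set a; b] := ab.
have : a \in [set u; v] by rewrite -eE ab !inE eqxx.
have : b \in [set u; v] by rewrite -eE ab !inE eqxx orbT.
have nab : a != b.
  by apply/eqP => e1; have := valP e; rewrite /= ab e1 setUid cards1.
rewrite !inE => /orP[]/eqP bE /orP[]/eqP aE; move: nab ab1 ab2;
  by rewrite aE bE ?eqxx.
Qed.

Lemma sum_edges_ends (P : pred (edge n)) (f : 'I_n * 'I_n -> R) : (forall a, 0 <= f a) ->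
  \sum_(e | P e) \sum_(a | ends_of e a) f a <= \sum_a f a.
Proof.
move=> f0; rewrite (exchange_big_dep predT) //=; apply: ler_sum => a _.
have [e /andP[Pe ea]|none] := pickP [pred e | P e && ends_of e a].
  rewrite (bigD1 e) ?Pe //= big1 ?addr0 // => e' /andP[/andP[_ /eqP ea'] ee'].
  case/eqP: ee'; apply: val_inj; rewrite -ea'; exact/eqP.
by rewrite big1 // => e eP; have := none e; rewrite /= eP.
Qed.

Lemma sum_all_edges_ends (f : 'I_n * 'I_n -> R) : (forall i, f (i, i) = 0) ->
  \sum_(e : edge n) \sum_(a | ends_of e a) f a = \sum_a f a.
Proof.
move=> f0; rewrite (exchange_big_dep predT) //=; apply: eq_bigr => -[i j] _.
have [ij|ij] := eqVneq i j.
  by rewrite ij f0 big1.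
have c2 : #|[set i; j]| == 2%N by rewrite cards2 ij.
pose e : edge n := exist (fun B : {set 'I_n} => #|B| == 2%N) _ c2.
rewrite (bigD1 e) /ends_of //= big1 ?addr0 // => e' /andP[/eqP ee' ne].
by case/eqP: ne; apply: val_inj.
Qed.

Section Fixed.
Variable z : 'I_n -> 'I_n -> 'I_n -> R.
Hypotheses (zM : martin z) (n0 : (0 < n)%N).

(** As the weight of an edge is the same for all roots, each edge may be evaluated at a root of its
    own, provided both ends choose the same one. *)
Lemma edge_weightE e (r : 'I_n -> 'I_n) : {in val e &, forall u v, r u = r v} ->
  edge_weight z e = \sum_(a | ends_of e a) z (r a.1) a.1 a.2.
Proof.
have [_ _ _ _ zz] := zM; have [u [v [uv eE]]] := edge_ends e => rE.
rewrite /edge_weight (sum_ends _ uv eE) /=.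
rewrite (eq_bigr (fun=> z (r u) u v + z (r u) v u)); last first.
  by move=> k _; rewrite (sum_ends _ uv eE) /=; apply: zz.
rewrite sumr_const card_ord -[X in _ * X]mulr_natl mulKf ?pnatr_eq0 -?lt0n //.
by rewrite (rE v u) // eE !inE eqxx ?orbT.
Qed.

Lemma sum_rows (r : 'I_n -> 'I_n) :
  \sum_(a : 'I_n * 'I_n) z (r a.1) a.1 a.2 = #|[set u | r u != u]|%:R.
Proof.
have [_ zk _ z1 _] := zM.
rewrite -(pair_bigA _ (fun u v => z (r u) u v)) /= -sum1_card natr_sum [RHS]big_mkcond /=.
apply: eq_bigr => u _; rewrite inE; have [ru|ru] := eqVneq (r u) u.
  by rewrite ru big1.
by rewrite z1 // eq_sym.
Qed.

(** The rank inequality of the graphic matroid. Orient each edge towards the representative [r] of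
    its component: a vertex other than its representative has total outgoing weight 1, a
    representative 0. *)
Lemma sum_edge_weight_le (l : seq (edge n)) (r : 'I_n -> 'I_n) : uniq l ->
    {in l, forall e, {in val e &, forall u v, r u = r v}} ->
  \sum_(e <- l) edge_weight z e <= #|[set u | r u != u]|%:R.
Proof.
move=> ul rl; rewrite -sum_rows big_uniq //=.
under eq_bigr => e el do rewrite (edge_weightE (rl e el)).
by apply: sum_edges_ends => a; case: zM.
Qed.

Lemma sum_all_edge_weight (k : 'I_n) :
  \sum_e edge_weight z e = #|[set u | k != u]|%:R.
Proof.
rewrite -(sum_rows (fun=> k)) -sum_all_edges_ends; last by move=> i; case: zM.
by apply: eq_bigr => e _; apply: edge_weightE.
Qed.

End Fixed.

(* [r] sends every vertex to a representative of its component. *)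
Definition spans (F : {set edge n}) (r : 'I_n -> 'I_n) (l : seq (edge n)) : Prop :=
  [/\ {in l, forall e, {in val e &, forall u v, r u = r v}},
      forall u, connect (adj F) u (r u),
      forall u, r (r u) = r u,
      #|F| = #|[set u | r u != u]|
    & {subset F <= l}].

Definition acyclic (F : {set edge n}) : Prop :=
  forall c : seq 'I_n, (2 < size c)%N -> ~ ucycle (adj F) c.

Lemma adj_mem (F : {set edge n}) u v : adj F u v -> exists2 e, e \in F & val e = [set u; v].
Proof. by move=> /exists_inP[e eF /eqP eE]; exists e. Qed.

Lemma adjU1 (F : {set edge n}) e u v :
  adj (e |: F) u v -> adj F u v \/ val e = [set u; v].
Proof.
move=> /adj_mem[f]; rewrite !inE => /orP[/eqP->|fF fE]; first by right.
by left; apply/exists_inP; exists f; rewrite ?fE.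
Qed.

(** A new cycle must use [e]. Rotated so that [e] comes first, the rest of it is a path in [F]
    between the ends of [e], along which [r] is constant. *)
Lemma acyclicU1 (F : {set edge n}) (r : 'I_n -> 'I_n) e u v :
    acyclic F -> (forall a b, adj F a b -> r a = r b) ->
    val e = [set u; v] -> r u != r v -> acyclic (e |: F).
Proof.
move=> acF rF eE ruv c c2 /andP[cyc uc].
have re a b : val e = [set a; b] -> r a != r b.
  move=> eab; have : u \in [set a; b] by rewrite -eab eE !inE eqxx.
  have : v \in [set a; b] by rewrite -eab eE !inE eqxx orbT.
  rewrite !inE => /orP[]/eqP vE /orP[]/eqP uE; move: ruv;
    by rewrite vE uE ?eqxx // eq_sym.
have rpath x p : path (adj F) x p -> r x = r (last x p).
  elim: p x => //= y p IHp x /andP[/rF -> /IHp].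
  by [].
have [a ac na] : exists2 a, a \in c & ~~ adj F a (next c a).
  apply: contrapT => none; apply: (acF c c2); rewrite /ucycle uc andbT.
  apply: cycle_from_next => // x xc; apply: contrapT => /negP nx.
  by apply: none; exists x.
have [i s cE] := rot_to ac.
have us : uniq (a :: s) by rewrite -cE rot_uniq.
have := cyc; rewrite -(rot_cycle i) cE /=.
move: na; rewrite -(next_rot i) // cE.
have : size (a :: s) = size c by rewrite -cE size_rot.
case: s cE us => [|b [|b' s]] cE us; [by move=> s1; rewrite -s1 in c2
  |by move=> s1; rewrite -s1 in c2|move=> _].
rewrite /= eqxx => nab /andP[ab pbs].
have eab : val e = [set a; b] by case: (adjU1 ab) => // ab'; rewrite ab' in nab.
case/negP: (re _ _ eab); apply/eqP.
move: us; rewrite cons_uniq => /andP[abs /andP[bs us]].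
have nain x y : x != a -> y != a -> adj (e |: F) x y -> adj F x y.
  move=> xa ya /adjU1[//|exy].
  have : a \in [set x; y] by rewrite -exy eab !inE eqxx.
  by rewrite !inE ![a == _]eq_sym (negbTE xa) (negbTE ya).
have pF : path (adj F) b (rcons (b' :: s) a).
  have : path (adj (e |: F)) b (rcons (b' :: s) a) := pbs.
  rewrite !rcons_path => /andP[pb la]; apply/andP; split.
    apply: (sub_in_path (P := [pred x | x != a])) pb.
      by move=> x y; rewrite !inE; apply: nain.
    by apply/allP => x xs; rewrite inE; apply: contraNneq abs => <-.
  case: (adjU1 la) => // ela.
  have : b \in [set last b (b' :: s); a] by rewrite -ela eab !inE eqxx orbT.
  have ba : b != a by apply: contraNneq abs => ->; rewrite inE eqxx.
  rewrite !inE (negbTE ba) orbF => /eqP bl; move: bs; rewrite {1}bl /=.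
  by rewrite mem_last.
by have := rpath _ _ pF; rewrite last_rcons.
Qed.

End Martin.

Section Greedy.
Import mathcomp.boot.fintype mathcomp.boot.finset.
Variables (R : realType) (n : nat) (z : 'I_n -> 'I_n -> 'I_n -> R).
Hypotheses (zM : martin z) (n0 : (0 < n)%N).
Implicit Types (e f : edge n) (F : {set edge n}) (r : 'I_n -> 'I_n) (l : seq (edge n)).

Lemma spans_adj F r l a b : spans F r l -> adj F a b -> r a = r b.
Proof.
move=> [rl _ _ _ Fl] /adj_mem[e /Fl el eE].
by apply: (rl e el); rewrite eE !inE eqxx ?orbT.
Qed.

(** The component of [u] is merged into that of [v]. Exactly one vertex, [r u], stops being a
    representative, which matches the added edge. *)
Lemma spansU1 F r l e u v : spans F r l -> val e = [set u; v] -> r u != r v ->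
  spans (e |: F) (fun w => if r w == r u then r v else r w) (rcons l e).
Proof.
move=> [rl rc rr cF Fl] eE ruv.
have mono : subrel (connect (adj F)) (connect (adj (e |: F))).
  apply: connect_sub => a b /adj_mem[f fF fE]; apply: connect1.
  by apply/exists_inP; exists f; rewrite ?fE // !inE fF orbT.
have csym : connect_sym (adj (e |: F)) by apply/sym_connect_sym/adj_sym.
split.
- move=> f; rewrite mem_rcons inE => /orP[/eqP->|fl] a b.
    rewrite eE !inE => /orP[]/eqP-> /orP[]/eqP->; rewrite ?eqxx //;
      by rewrite eq_sym (negbTE ruv).
  by move=> af bf; rewrite (rl f fl a b).
- move=> w; case: eqVneq => [rw|_]; last exact/mono/rc.
  apply: connect_trans (mono _ _ (rc w)) _; rewrite rw.
  apply: connect_trans (_ : connect _ (r u) u) _; first by rewrite csym mono.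
  apply: connect_trans (connect1 _) (mono _ _ (rc v)).
  by rewrite (adj_edge _ eE) !inE eqxx.
- move=> w; case: (eqVneq (r w) (r u)) => [_|rwu]; rewrite rr.
    by rewrite eq_sym (negbTE ruv).
  by rewrite (negbTE rwu).
- have eF : e \notin F.
    apply: contra ruv => /Fl el; apply/eqP; apply: (rl e el); rewrite eE !inE eqxx ?orbT //.
  rewrite (_ : [set w | _] = r u |: [set w | r w != w]).
    by rewrite !cardsU1 eF cF inE rr eqxx.
  apply/setP => w; rewrite !inE; case: (eqVneq (r w) (r u)) => [rw|rwu].
    rewrite rw [r u == w]eq_sym orbN; apply: contra ruv => /eqP rv.
    by have := rr v; rewrite rv rw => ->.
  by case: (eqVneq w (r u)) => // wu; rewrite wu rr eqxx in rwu.
- by move=> f; rewrite !inE mem_rcons inE => /orP[->//|/Fl ->]; rewrite orbT.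
Qed.

(** Kruskal's algorithm on edges of decreasing cost. The level [mu] turns summation by parts into an
    induction: the shorter list is used at level [c e], with [e] the last and cheapest edge, and the
    change of level costs [c e - mu] times the rank inequality. *)
Lemma greedy_spanning_forest (c : edge n -> R) l :
    uniq l -> pairwise (fun e f => c f <= c e) l ->
  exists F r, [/\ spans F r l, acyclic F & forall mu, {in l, forall e, mu <= c e} ->
    \sum_(e <- l) (c e - mu) * edge_weight z e <= \sum_(e in F) (c e - mu)].
Proof.
elim/last_ind: l => [|l e IHl].
  move=> _ _; exists set0, id; split.
  - split=> //.
    + by rewrite cards0; apply/esym/eqP; rewrite cards_eq0; apply/eqP/setP => u; rewrite !inE eqxx.
    + by move=> e; rewrite inE.
  - move=> [|a c'] // c2 /andP[cyc _]; have := next_cycle cyc (mem_head a c').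
    by move=> /adj_mem[e]; rewrite inE.
  - by move=> mu _; rewrite big_nil big_set0.
rewrite rcons_uniq pairwise_rcons => /andP[el ul] /andP[/allP lec pl].
have [F [r [Fr acF opt]]] := IHl ul pl.
have ule : uniq (rcons l e) by rewrite rcons_uniq el.
have [u [v [uv eE]]] := edge_ends e.
(* At level [c e] the edge [e] contributes nothing, so this covers both accepting and rejecting
   it. *)
have step F' r' mu : spans F' r' (rcons l e) -> mu <= c e ->
    \sum_(f in F') (c f - c e) = \sum_(f in F) (c f - c e) ->
  \sum_(f <- rcons l e) (c f - mu) * edge_weight z f <= \sum_(f in F') (c f - mu).
  move=> Fr' muc F'F.
  have splitc f : c f - mu = (c f - c e) + (c e - mu) by ring.
  under [leRHS]eq_bigr do rewrite splitc.
  under [leLHS]eq_bigr do rewrite splitc mulrDl.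
  rewrite [leLHS]big_split [leRHS]big_split /=; apply: lerD.
    rewrite F'F -cats1 big_cat big_seq1 /= subrr mul0r addr0.
    exact: opt.
  rewrite -mulr_sumr sumr_const -[leRHS]mulr_natr; apply: ler_wpM2l; first by rewrite subr_ge0.
  have [rl _ _ -> _] := Fr'.
  exact: sum_edge_weight_le.
have [ruv|ruv] := eqVneq (r u) (r v).
  exists F, r; have Fr' : spans F r (rcons l e).
    have [rl rc rr cF Fl] := Fr; split=> //; last by move=> f /Fl; rewrite mem_rcons inE => ->; rewrite orbT.
    move=> f; rewrite mem_rcons inE => /orP[/eqP->|/rl //] a b.
    by rewrite eE !inE => /orP[]/eqP-> /orP[]/eqP->.
  split=> // mu muc; apply: step Fr' _ _ => //; apply: muc.
  by rewrite mem_rcons mem_head.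
have Fr' := spansU1 Fr eE ruv.
exists (e |: F), (fun w => if r w == r u then r v else r w); split=> //.
  by apply: acyclicU1 acF _ eE ruv => a b; apply: spans_adj Fr.
move=> mu muc; apply: (step _ _ _ Fr'); first by apply: muc; rewrite mem_rcons mem_head.
rewrite big_setU1 /= ?subrr ?add0r //.
by have [_ _ _ _ Fl] := Fr; apply: contra el => /Fl.
Qed.

Lemma greedy_spanning_tree (c : edge n -> R) :
  exists2 T, spanning_tree T & \sum_e c e * edge_weight z e <= \sum_(e in T) c e.
Proof.
pose leT := (fun e f => c f <= c e) : rel (edge n).
have leT_total : total leT by move=> e f; apply: le_total.
have leT_trans : transitive leT by move=> f e g ef fg; apply: le_trans fg ef.
pose l := sort leT (enum [set: edge n]).
have ul : uniq l by rewrite sort_uniq enum_uniq.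
have pl : pairwise leT l by rewrite -sorted_pairwise // sort_sorted.
have inl e : e \in l by rewrite mem_sort mem_enum inE.
have [F [r [[rl rc rr cF Fl] acF opt]]] := greedy_spanning_forest ul pl.
have rconst u v : r u = r v.
  have [->//|uv] := eqVneq u v.
  have c2 : #|[set u; v]| == 2%N by rewrite cards2 uv.
  pose e : edge n := exist (fun B : {set 'I_n} => #|B| == 2%N) _ c2.
  by apply: (rl e (inl e)); rewrite !inE eqxx ?orbT.
exists F.
  split=> // u v; apply: connect_trans (rc u) _; rewrite (rconst u v).
  by rewrite (sym_connect_sym (@adj_sym _ F)).
(* Any lower bound on the costs would do: the total weight equals #|F|, so [mu] cancels. *)
pose mu := - \sum_e `|c e|.
have mule e : mu <= c e.
  rewrite /mu lerNl (le_trans (ler_norm _)) // normrN (bigD1 e) //= lerDl.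
  exact: sumr_ge0.
have := opt mu (fun e _ => mule e); rewrite big_uniq //=.
rewrite (eq_bigl predT) => [|e]; last by rewrite inl.
pose k := r (Ordinal n0).
have total : \sum_e edge_weight z e = #|F|%:R.
  rewrite (sum_all_edge_weight zM n0 k) cF; congr (#|pred_of_set _|%:R).
  by apply/setP => u; rewrite !inE (rconst u (Ordinal n0)).
under eq_bigr do rewrite mulrBl; rewrite sumrB -mulr_sumr total.
by rewrite [leRHS]sumrB sumr_const -[X in _ <= _ - X]mulr_natr lerD2r.
Qed.

End Greedy.

Local Open Scope classical_set_scope.

(** * Affine functions and faces of polyhedra *)

Section AffineFunctions.
Variable R : realType.

Lemma dot_linear (I : finType) (c : vec R I) : linear (dot c : vec R I -> R^o).
Proof.
move=> a x y; rewrite /dot scaler_sumr -big_split /=; apply: eq_bigr => i _.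
by rewrite !ffunE /GRing.scale /= mulrDr mulrCA.
Qed.

HB.instance Definition _ (I : finType) (c : vec R I) :=
  GRing.isLinear.Build R (vec R I) R^o _ (dot c : vec R I -> R^o) (dot_linear c).

Definition affine_fun (I : finType) (g : vec R I -> R) : Prop :=
  exists (c : vec R I) (b : R), forall x, g x = dot c x + b.

Lemma affine_fun_sum_combination (I K : finType) (g : vec R I -> R) (w : K -> R)
    (x : K -> vec R I) :
  affine_fun g -> \sum_k w k = 1 ->
  g (\sum_k w k *: x k) = \sum_k w k * g (x k).
Proof.
move=> [c [b gE]] w1; rewrite gE [dot c _]linear_sum.
under [in RHS]eq_bigr do rewrite gE mulrDr.
rewrite big_split /= -mulr_suml w1 mul1r; congr (_ + _).
by apply: eq_bigr => k _; rewrite linearZ.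
Qed.

Lemma affine_fun_line (I : finType) (g : vec R I -> R) (x y : vec R I) (t : R) :
  affine_fun g -> g (x + t *: (y - x)) = (1 - t) * g x + t * g y.
Proof.
move=> [c [b gE]]; rewrite !gE [dot c (x + _)]linearD linearZ /= [dot c (_ - _)]linearB /=.
by rewrite /GRing.scale /=; ring.
Qed.

Lemma affine_map_sum_combination (I J K : finType) (f : vec R I -> vec R J)
    (w : K -> R) (x : K -> vec R I) :
  affine_map f -> \sum_k w k = 1 ->
  f (\sum_k w k *: x k) = \sum_k w k *: f (x k).
Proof.
move=> [L [b fE]] w1; rewrite fE linear_sum.
under [in RHS]eq_bigr do rewrite fE scalerDr.
rewrite big_split /= -scaler_suml w1 scale1r; congr (_ + _).
by apply: eq_bigr => k _; rewrite linearZ.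
Qed.

Lemma ffun_sum_delta (I : finType) (x : vec R I) :
  x = \sum_i x i *: ([ffun j => (i == j)%:R] : vec R I).
Proof.
apply/ffunP => j; rewrite sum_ffunE (bigD1 j) //= !ffunE eqxx big1 ?addr0.
  by rewrite /GRing.scale /= mulr1.
by move=> i ij; rewrite !ffunE (negbTE ij) scaler0.
Qed.

Lemma affine_fun_comp (I J : finType) (g : vec R J -> R)
    (f : vec R I -> vec R J) :
  affine_fun g -> affine_map f -> affine_fun (g \o f).
Proof.
move=> [c [b gE]] [L [a fE]].
exists [ffun i => dot c (L [ffun j => (i == j)%:R])], (dot c a + b) => x /=.
rewrite gE fE [dot c _]linearD -addrA; congr (_ + _).
rewrite {1}[x]ffun_sum_delta [L _]linear_sum [LHS]linear_sum.
by apply: eq_bigr => i _; rewrite ffunE mulrC !linearZ.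
Qed.

Lemma affine_fun_sum (I K : finType) (P : pred K) (g : K -> vec R I -> R) :
  (forall k, P k -> affine_fun (g k)) ->
  affine_fun (fun x => \sum_(k | P k) g k x).
Proof.
move=> gA; have /boolp.choice [cb gE] : forall k, exists cb : vec R I * R,
    P k -> forall x, g k x = dot cb.1 x + cb.2.
  move=> k; case: (boolP (P k)) => [/gA [c [b gE]]|_]; first by exists (c, b).
  by exists (0, 0).
exists (\sum_(k | P k) (cb k).1), (\sum_(k | P k) (cb k).2) => x.
rewrite (eq_bigr _ (fun k Pk => gE k Pk x)) big_split /=; congr (_ + _).
rewrite /dot exchange_big /=; apply: eq_bigr => i _.
by rewrite sum_ffunE mulr_suml.
Qed.

Lemma polyhedronP (I : finType) (Q : set (vec R I)) : polyhedron Q ->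
  exists (k : nat) (g : 'I_k -> vec R I -> R),
    (forall i, affine_fun (g i)) /\ Q = [set x | forall i, 0 <= g i x].
Proof.
move=> [k [a [b ->]]]; exists k, (fun i x => b i - dot (a i) x); split.
  move=> i; exists (- a i), (b i) => x; rewrite addrC; congr (_ + _).
  by rewrite /dot -sumrN; apply: eq_bigr => j _; rewrite !ffunE mulNr.
by apply/seteqP; split => x /= xQ i; have := xQ i; rewrite subr_ge0.
Qed.

Lemma faceP (I : finType) (Q F : set (vec R I)) :
  face Q F <-> exists h : vec R I -> R, [/\ affine_fun h,
    forall x, Q x -> 0 <= h x & F = Q `&` [set x | h x = 0]].
Proof.
split=> [[c [d [cd ->]]]|[h [[c [b hE]] h0 ->]]].
  exists (fun x => d - dot c x); split.
  - exists (- c), d => x; rewrite addrC; congr (_ + _).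
    by rewrite /dot -sumrN; apply: eq_bigr => j _; rewrite !ffunE mulNr.
  - by move=> x /cd; rewrite subr_ge0.
  - congr (_ `&` _); apply/seteqP; split => x /=; first by move->; rewrite subrr.
    by move/eqP; rewrite subr_eq0 => /eqP.
have dotN x : dot (- c) x = - dot c x.
  by rewrite /dot -sumrN; apply: eq_bigr => j _; rewrite !ffunE mulNr.
exists (- c), b; split.
  by move=> x /h0; rewrite hE dotN; lra.
by congr (_ `&` _); apply/seteqP; split => x /=; rewrite hE dotN; lra.
Qed.

End AffineFunctions.

Section Faces.
Variables (R : realType) (I K : finType) (g : K -> vec R I -> R).
Hypothesis g_affine : forall k, affine_fun (g k).
Let Q : set (vec R I) := [set x | forall k, 0 <= g k x].
Implicit Types (h : vec R I -> R) (F : set (vec R I)).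

Lemma small_multiple (a b : K -> R) :
  exists2 e, 0 < e & forall k, 0 < a k -> e * b k <= a k.
Proof.
pose s := \sum_(k | 0 < a k) `|b k| / a k.
have s0 : 0 <= s by apply: sumr_ge0 => k ak; rewrite divr_ge0 // ltW.
exists (1 + s)^-1; first by rewrite invr_gt0; lra.
move=> k ak; rewrite mulrC ler_pdivrMr; last by lra.
have : `|b k| / a k <= s.
  by rewrite /s (bigD1 k) //= lerDl sumr_ge0 // => j /andP[aj _]; rewrite divr_ge0 // ltW.
by rewrite ler_pdivrMr // => bs; have := ler_norm (b k); rewrite mulrDr; nra.
Qed.

(** If a constraint tight at [x] is slack at some [y] of the face, the midpoint of [x] and [y] has
    fewer tight constraints. *)
Lemma relative_interior h x : affine_fun h -> Q x -> h x = 0 ->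
  exists x1, [/\ Q x1, h x1 = 0
    & forall k, g k x1 = 0 -> forall y, Q y -> h y = 0 -> g k y = 0].
Proof.
move=> hA; have [m] := ubnP #|[set k | g k x == 0]%SET|.
elim: m x => // m IHm x; rewrite ltnS => xm Qx hx.
have [[k [gkx [y [Qy hy gky]]]]|none] := pselect (exists k, g k x = 0 /\
    exists y, [/\ Q y, h y = 0 & g k y <> 0]); last first.
  exists x; split=> // k gkx y Qy hy; apply: contrapT => gky.
  by apply: none; exists k; split=> //; exists y.
have mid f : affine_fun f -> f (x + 2^-1 *: (y - x)) = 2^-1 * (f x + f y).
  by move=> fA; rewrite affine_fun_line //; lra.
have g0 j : 0 <= g j x /\ 0 <= g j y by split; [apply: Qx|apply: Qy].
apply: (IHm (x + 2^-1 *: (y - x))).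
- apply: leq_trans xm; apply: proper_card; apply/properP; split.
    apply/fintype.subsetP => j; rewrite !inE mid // => /eqP e.
    by have [? ?] := g0 j; apply/eqP; lra.
  exists k; rewrite !inE ?gkx // mid // gkx; apply/eqP.
  by have [? ?] := g0 k; lra.
- by move=> j; rewrite mid //; have [? ?] := g0 j; lra.
- by rewrite mid // hx hy; lra.
Qed.

(** The segment from [x] to [x1] can be prolonged slightly beyond [x1] inside [Q]. An affine [h]
    that vanishes at [x1] and is nonnegative on both sides vanishes along it. *)
Lemma face_closed_tight h x1 x : affine_fun h -> (forall y, Q y -> 0 <= h y) ->
    Q x1 -> h x1 = 0 -> Q x -> (forall k, g k x1 = 0 -> g k x = 0) -> h x = 0.
Proof.
move=> hA h0 Qx1 hx1 Qx tight.
have [e e0 ge] := small_multiple (g^~ x1) (g^~ x).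
have : Q (x1 + (- e) *: (x - x1)).
  move=> k; rewrite affine_fun_line //; have := Qx1 k.
  rewrite le_eqVlt => /predU1P[/esym gk|gk]; first by rewrite gk tight //; lra.
  by have := ge k gk; nra.
move=> /h0; rewrite affine_fun_line // hx1; have := h0 x Qx; nra.
Qed.

Definition tight_set F : {set K} := [set k | `[< forall x, F x -> g k x = 0 >]]%SET.

Lemma tight_setP F k : reflect (forall x, F x -> g k x = 0) (k \in tight_set F).
Proof. by rewrite inE; apply: asboolP. Qed.

Lemma face_tight_subset F F' : face Q F -> F !=set0 -> face Q F' ->
  tight_set F \subset tight_set F' -> F' `<=` F.
Proof.
move=> /faceP[h [hA h0 FE]] [x Fx] /faceP[h' [_ _ F'E]] FF' y F'y.
have Qy : Q y by move: F'y; rewrite F'E => -[].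
move: Fx; rewrite FE => -[Qx hx].
have [x1 [Qx1 hx1 x1min]] := relative_interior hA Qx hx.
split=> //; apply: (face_closed_tight hA h0 Qx1 hx1 Qy) => k gk.
have /tight_setP : k \in tight_set F'.
  apply: (fintype.subsetP FF'); apply/tight_setP => z; rewrite FE => -[Qz hz].
  exact: x1min.
exact.
Qed.

(** A strictly larger proper face has a strictly smaller tight set, so enlarging terminates. *)
Lemma proper_face_sub_facet F : proper_face Q F -> exists2 F', facet Q F' & F `<=` F'.
Proof.
have [m] := ubnP #|tight_set F|; elim: m F => // m IHm F; rewrite ltnS => Fm pF.
have [fF|nF] := pselect (facet Q F); first by exists F.
have [F1 [pF1 FF1 neq]] : exists F1, [/\ proper_face Q F1, F `<=` F1 & F1 <> F].
  apply: contrapT => none; apply: nF; split=> // F1 pF1 FF1.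
  by apply: contrapT => neq; apply: none; exists F1.
have [||F2 fF2 F12] := IHm F1 => //; last by exists F2 => // x /FF1 /F12.
apply: leq_trans Fm; apply: proper_card; rewrite properE; apply/andP; split.
  by apply/fintype.subsetP => k /tight_setP t; apply/tight_setP => x /FF1 /t.
apply/negP => le; apply: neq; apply/seteqP; split=> //.
by case: pF pF1 => [fF F0 _] [fF1 _ _]; apply: face_tight_subset.
Qed.

Lemma constraint_face k x y : Q x -> g k x = 0 -> Q y -> g k y <> 0 ->
  proper_face Q (Q `&` [set z | g k z = 0]).
Proof.
move=> Qx gx Qy gy; split.
- by apply/faceP; exists (g k); split=> // z; apply.
- by exists x.
- by apply/eqP => e; apply: gy; move: Qy; rewrite -[in Q y]e => -[].
Qed.

(** Some constraint tight at a relative interior point of [F] is slack at a point of [Q] outside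
    [F]. Its proper face contains [F], and maximality gives equality. *)
Lemma facet_constraint F : facet Q F -> exists k,
  (exists2 x, Q x & g k x <> 0) /\ F = Q `&` [set x | g k x = 0].
Proof.
move=> [[/faceP[h [hA h0 FE]] [x Fx] /eqP FQ] Fmax].
have [y Qy hy] : exists2 y, Q y & h y <> 0.
  apply: contrapT => none; apply: FQ; rewrite FE; apply/seteqP; split.
    by move=> z [].
  by move=> z Qz; split=> //=; apply: contrapT => hz; apply: none; exists z.
move: Fx; rewrite FE => -[Qx hx].
have [x1 [Qx1 hx1 x1min]] := relative_interior hA Qx hx.
have [k [gkx1 gky]] : exists k, g k x1 = 0 /\ g k y <> 0.
  apply: contrapT => none; apply: hy; apply: (face_closed_tight hA h0 Qx1 hx1 Qy).
  by move=> k gk; apply: contrapT => gy; apply: none; exists k.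
exists k; split; first by exists y.
rewrite -FE; apply/esym/Fmax; first exact: constraint_face Qx1 gkx1 Qy gky.
by move=> z; rewrite FE => -[Qz hz]; split=> //=; apply: x1min.
Qed.

(** The segment from a relative interior point [x0] of [Q] to [y] leaves [Q] at a point of a facet
    [F]; a functional vanishing there and positive at [x0] is negative at [y]. Every functional
    defining [F] is allowed, so that one invariant under the stabilizer of [F] can be chosen. *)
Lemma facet_cuts_off y : Q !=set0 -> ~ Q y ->
    (forall k, (forall x, Q x -> g k x = 0) -> g k y = 0) ->
  exists2 F, facet Q F & forall l, affine_fun l -> (forall x, Q x -> 0 <= l x) ->
    (forall x, Q x -> (l x = 0 <-> F x)) -> l y < 0.
Proof.
move=> [x Qx] nQy affy.
have zA : affine_fun ((fun=> 0) : vec R I -> R).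
  by exists 0, 0 => z; rewrite /dot big1 ?addr0 // => i _; rewrite ffunE mul0r.
have [x0 [Qx0 _ x0min]] := relative_interior zA Qx erefl.
have [k0 gk0] : exists k, g k y < 0.
  apply: contrapT => none; apply: nQy => k; rewrite leNgt; apply/negP => gk.
  by apply: none; exists k.
have gx0 k : g k y < 0 -> 0 < g k x0.
  move=> gk; rewrite lt_neqAle Qx0 andbT eq_sym; apply/eqP => e.
  by have := affy k (fun z Qz => x0min k e z Qz erefl); lra.
(* The parameter at which constraint [k] vanishes on the segment; the smallest one gives the exit
   point. *)
pose t k := g k x0 / (g k x0 - g k y).
case: (@arg_minP _ _ _ k0 (fun k => g k y < 0) t gk0) => k gk tmin.
have gkx := gx0 _ gk; have d0 : 0 < g k x0 - g k y by lra.
have t0 : 0 < t k by rewrite divr_gt0.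
have t1 : t k < 1 by rewrite ltr_pdivrMr //; lra.
pose z := x0 + t k *: (y - x0).
have Qz : Q z.
  move=> j; rewrite affine_fun_line //; have [gj|gj] := ltP (g j y) 0; last first.
    by have := Qx0 j; nra.
  have := tmin j gj; have := gx0 j gj => gj0; rewrite ler_pdivlMr; last by lra.
  by nra.
have gz : g k z = 0.
  by rewrite affine_fun_line // /t; field; rewrite gt_eqF.
have pF := constraint_face Qz gz Qx0 (_ : g k x0 <> 0).
have [|F fF FF] := proper_face_sub_facet (pF _); first by apply/eqP; rewrite gt_eqF.
exists F => // l lA l0 lF; have lz : l z = 0 by apply/lF => //; apply: FF.
have lx0 : 0 < l x0.
  rewrite lt_neqAle l0 // andbT eq_sym; apply/eqP => e.
  case: fF => [[ffF F0 /eqP FQ] _]; apply: FQ; apply/seteqP; split.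
    by case/faceP: ffF => h [_ _ ->] w [].
  have /faceP[h [hA h0 FE]] := ffF.
  have hx0 : h x0 = 0 by have /lF := e; rewrite FE => /(_ Qx0) [].
  move=> w Qw; rewrite FE; split=> //=.
  apply: (face_closed_tight hA h0 Qx0 hx0 Qw) => j gj; exact: x0min gj w Qw erefl.
by move: lz; rewrite affine_fun_line //; nra.
Qed.

End Faces.

Section FacetCounting.
Variable R : realType.

Lemma has_nb_facets_le (I K : finType) (g : K -> vec R I -> R) (N : {set K}) :
    (forall k, affine_fun (g k)) ->
    (forall k x, k \notin N -> (forall j, 0 <= g j x) -> g k x = 0) ->
  exists2 m, (m <= #|N|)%N & has_nb_facets [set x | forall k, 0 <= g k x] m.
Proof.
move=> gA geq; set Q := [set x | _].
pose s := [seq Q `&` [set x | g k x = 0] | k <- enum N].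
have le : ([set F | facet Q F] #<= `I_#|N|)%card.
  apply: card_le_trans (card_image_le (nth set0 s) `I_#|N|).
  apply: subset_card_le => F /(facet_constraint gA) [k [[x Qx gkx] ->]].
  have kN : k \in enum N.
    by rewrite mem_enum; apply: contra_notT gkx => kN; apply: geq.
  exists (index k (enum N)); first by rewrite /= cardE index_mem.
  by rewrite (nth_map k) ?index_mem // nth_index.
have /finite_setP[m em] : finite_set [set F | facet Q F].
  by apply/finite_set_leP; exists #|N|.
by exists m => //; rewrite -card_le_II -(card_le_eql em).
Qed.

End FacetCounting.

Section FacetAction.
Variables (R : realType) (gT : finGroupType) (I : finType).
Variables (Q : set (vec R I)) (rho : vec R I -> gT -> vec R I).
Hypothesis rhoQ : affine_action_on Q rho.

(* For [F] included in [Q], this is the image of [F] under [rho _ s]. *)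
Definition face_act (F : set (vec R I)) (s : gT) : set (vec R I) :=
  [set x | Q x /\ F (rho x s^-1)%g].

Lemma face_act1 F : F `<=` Q -> face_act F 1%g = F.
Proof.
have [_ _ r1 _] := rhoQ; move=> FQ; apply/seteqP; split => x /=.
  by case=> Qx; rewrite invg1 r1.
by move=> Fx; split; [exact: FQ|rewrite invg1 r1 //; exact: FQ].
Qed.

Lemma face_actM F s t : face_act F (s * t)%g = face_act (face_act F s) t.
Proof.
have [_ rQ _ rM] := rhoQ; rewrite /face_act; apply/seteqP; split => x /=; rewrite invMg.
  by case=> Qx; rewrite rM // => Fx; split=> //; split=> //; apply: rQ.
by case=> Qx [_ Fx]; split=> //; rewrite rM.
Qed.

Lemma face_actK s F : F `<=` Q -> face_act (face_act F s) s^-1%g = F.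
Proof. by move=> FQ; rewrite -face_actM mulgV face_act1. Qed.

Lemma proper_face_sub F : proper_face Q F -> F `<=` Q.
Proof. by case=> -[c [d [_ ->]]] _ _ x []. Qed.

Lemma proper_face_act F s : proper_face Q F -> proper_face Q (face_act F s).
Proof.
have [rA rQ r1 rM] := rhoQ; move=> pF; have FQ := proper_face_sub pF.
case: (pF) => /faceP[h [hA h0 FE]] [x Fx] /eqP nFQ; split.
- apply/faceP; exists (h \o rho^~ s^-1%g); split.
  + exact: affine_fun_comp.
  + by move=> y Qy; apply/h0/rQ.
  + apply/seteqP; split => y /= [Qy]; rewrite FE => -[]//.
    by move=> hy; split=> //; split=> //; apply: rQ.
- exists (rho x s); split; first exact/rQ/FQ.
  by rewrite -rM ?mulgV ?r1 //; apply: FQ.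
- apply/eqP => e; apply: nFQ; rewrite -(face_actK s FQ) e.
  by apply/seteqP; split => y; [case|move=> Qy; split=> //; apply: rQ].
Qed.

Lemma facet_act F s : facet Q F -> facet Q (face_act F s).
Proof.
move=> [pF Fmax]; split; first exact: proper_face_act.
move=> F' pF' le; have F'Q := proper_face_sub pF'.
rewrite -(Fmax (face_act F' s^-1%g)); first by rewrite -{2}[s]invgK face_actK.
  exact: proper_face_act.
rewrite -{1}(face_actK s (proper_face_sub pF)).
by move=> x [Qx /le F'x]; split.
Qed.

(** Orbit-stabilizer: distinct cosets of the stabilizer give distinct images of [F], all among the
    [k] facets. *)
Lemma facet_stabilizer k F : has_nb_facets Q k -> facet Q F ->
  exists2 H : {group gT}, forall s, (s \in H) = `[< face_act F s = F >]
    & (#|[set: gT]%SET : H|%g <= k)%N.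
Proof.
move=> /card_set_bijP[f [fI finj _]] fF; have FQ := proper_face_sub (proj1 fF).
pose A := [set s | `[< face_act F s = F >]]%SET.
have AE s : s \in A = `[< face_act F s = F >] by rewrite inE.
have gA : group_set A.
  apply/group_setP; split; first by rewrite AE; apply/asboolP/face_act1.
  move=> s t; rewrite !AE => /asboolP sF /asboolP tF.
  by apply/asboolP; rewrite face_actM sF.
exists (Group gA) => //.
have ltk s : (f (face_act F s) < k)%N by apply: fI; apply: facet_act.
pose e s : 'I_k := Ordinal (ltk s).
have e_inj s t : e s = e t -> (A :* s = A :* t)%g.
  move=> [] /finj; rewrite !inE => /(_ (facet_act s fF) (facet_act t fF)) st.
  apply/(rcoset_eqP (G := Group gA))/rcosetP; exists (s * t^-1)%g; last by rewrite mulgKV.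
  by rewrite AE; apply/asboolP; rewrite face_actM st face_actK.
change (#|rcosets A [set: gT]%SET| <= k)%N.
have /card_in_imset <- : {in rcosets A [set: gT]%SET &,
    injective (fun C : {set gT} => e (repr C))}.
  move=> C D /rcosetsP[s _ ->] /rcosetsP[t _ ->] /e_inj.
  by rewrite !(rcoset_repr (Group gA)).
by rewrite -[leqRHS]card_ord max_card.
Qed.

End FacetAction.

(** * The lower bound *)

Section InducedWeight.
Variables (R : realType) (n : nat).
Implicit Types (S : {set 'I_n}) (x : vec R (edge n)) (T : {set edge n}).

Definition induced_weight S x : R := \sum_(e : edge n | val e \subset S) x e.

Lemma induced_weight_affine S : affine_fun (induced_weight S).
Proof.
exists [ffun e : edge n => (val e \subset S)%:R], 0 => x; rewrite addr0 /dot /induced_weight.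
rewrite big_mkcond; apply: eq_bigr => e _; rewrite ffunE.
by case: (_ \subset _); rewrite ?mul1r ?mul0r.
Qed.

Lemma induced_weight_chi S T :
  induced_weight S (chi R T) = #|[set e in T | val e \subset S]%SET|%:R.
Proof.
rewrite /induced_weight -sum1_card natr_sum big_mkcond [RHS]big_mkcond /=.
by apply: eq_bigr => e _; rewrite ffunE !inE andbC; case: (_ \subset _); case: (_ \in _).
Qed.

Lemma edge_relabelK (s : 'S_n) : cancel (edge_relabel s) (edge_relabel s^-1%g).
Proof.
move=> e; apply: val_inj => /=; rewrite -imset_comp -[RHS]imset_id.
by apply: eq_imset => v /=; rewrite permK.
Qed.

Lemma induced_weight_relabel S (A : {set 'I_n}) x (s : 'S_n) : [set s v | v in A]%SET = S ->
  induced_weight S (relabel_action R n x s) = induced_weight A x.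
Proof.
move=> <-; rewrite /induced_weight (reindex_inj (can_inj (edge_relabelK s))) /=.
apply: eq_big => [e|e _]; last by rewrite ffunE edge_relabelK.
rewrite /=; apply/idP/idP => [|le]; last exact: imsetS.
move=> /fintype.subsetP le; apply/fintype.subsetP => v ve.
have /imsetP[w wA /perm_inj ->] := le (s v) (imset_f _ ve).
exact: wA.
Qed.

(** Three tree edges inside a triple would form a triangle. *)
Lemma tree_induced_weight_le S T : #|S| = 3%N -> spanning_tree T ->
  induced_weight S (chi R T) <= 2.
Proof.
move=> cS [_ acyc]; rewrite induced_weight_chi ler_nat leqNgt; apply/negP => big.
have /card_gt2P[a [b [c [[aS bS cS'] [ab bc ca]]]]] : (2 < #|S|)%N by rewrite cS.
have c3 : #|[set e : edge n | val e \subset S]%SET| = 3%N.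
  rewrite -(card_imset _ val_inj) -[RHS]/'C(3, 2) -cS -cards_draws.
  apply: eq_card => B; rewrite !inE; apply/imsetP/andP => [[e]|[BS B2]].
    by rewrite inE => eS ->; split=> //; apply: (valP e).
  by exists (exist _ B B2); rewrite ?inE.
have sub : [set e in T | val e \subset S]%SET = [set e : edge n | val e \subset S]%SET.
  apply/eqP; rewrite eqEcard c3 big andbT.
  by apply/fintype.subsetP => e; rewrite !inE => /andP[].
have adjS u v : u != v -> u \in S -> v \in S -> adj T u v.
  move=> uv uS vS; have B2 : #|[set u; v]%SET| == 2%N by rewrite cards2 uv.
  pose e : edge n := exist (fun B : {set 'I_n} => #|B| == 2%N) _ B2.
  apply/exists_inP; exists e => //.
  have : e \in [set e : edge n | val e \subset S]%SET.
    by rewrite inE; apply/fintype.subsetP => w; rewrite !inE => /orP[]/eqP->.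
  by rewrite -sub inE => /andP[].
apply: (acyc [:: a; b; c]) => //; apply/andP; split => /=.
  by rewrite !adjS.
by rewrite !inE negb_or ab bc eq_sym ca.
Qed.

Lemma P_ST_induced_weight_le S x : #|S| = 3%N -> @P_ST R n x ->
  induced_weight S x <= 2.
Proof.
move=> cS [k [w [y [yT w0 w1 ->]]]].
rewrite (affine_fun_sum_combination _ (induced_weight_affine S) w1).
rewrite -[leRHS]mul1r -[X in X * _]w1 mulr_suml; apply: ler_sum => i _.
apply: ler_wpM2l => //; have [T Tst <-] := yT i.
exact: tree_induced_weight_le.
Qed.

Lemma P_ST_chi T : spanning_tree T -> @P_ST R n (chi R T).
Proof.
move=> Tst; exists 1%N, (fun=> 1), (fun=> chi R T); split=> //.
- by move=> _; exists T.
- by rewrite big_ord1.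
- by rewrite big_ord1 scale1r.
Qed.

End InducedWeight.

(** A functional defining [F] is summed over the stabilizer [H]. All summands are nonnegative on [Q]
    and vanish there exactly on [F], hence so does the sum. *)
Lemma invariant_facet_functional (R : realType) (gT : finGroupType) (I : finType)
    (Q : set (vec R I)) (rho : vec R I -> gT -> vec R I) (F : set (vec R I))
    (H : {group gT}) :
    affine_action_on Q rho -> facet Q F ->
    (forall s, (s \in H) = `[< face_act Q rho F s = F >]) ->
  exists l : vec R I -> R, [/\ affine_fun l, forall x, Q x -> 0 <= l x,
    forall x, Q x -> (l x = 0 <-> F x)
    & forall x s, Q x -> s \in H -> l (rho x s) = l x].
Proof.
move=> rhoQ fF HF; have [rA rQ r1 rM] := rhoQ.
have [h [hA h0 FE]] : exists h : vec R I -> R, [/\ affine_fun h,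
    forall x, Q x -> 0 <= h x & F = Q `&` [set x | h x = 0]].
  by case: fF => -[/faceP].
have rF x s : Q x -> s \in H -> F (rho x s) <-> F x.
  move=> Qx sH; have /asboolP e : `[< face_act Q rho F s^-1%g = F >].
    by rewrite -HF groupV.
  by rewrite -[in X in _ <-> X]e /face_act /= invgK; split=> // -[].
exists (fun x => \sum_(s in H) h (rho x s)); split.
- by apply: affine_fun_sum => s _; apply: (affine_fun_comp hA (rA s)).
- by move=> x Qx; apply: sumr_ge0 => s _; apply/h0/rQ.
- move=> x Qx; split=> [/eqP|Fx].
    rewrite psumr_eq0; last by move=> s _; apply/h0/rQ.
    move=> /allP/(_ 1%g); rewrite mem_index_enum group1 r1 //= => /(_ isT)/eqP hx.
    by rewrite FE.
  apply: big1 => s sH; have /rF := sH; move=> /(_ x Qx)[_ /(_ Fx)].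
  by rewrite {1}FE => -[].
- move=> x s Qx sH; rewrite [RHS](reindex_inj (mulgI s)) /=.
  by apply: eq_big => t; [rewrite groupMl|rewrite rM].
Qed.

Section LowerBound.
Variables (R : realType) (n : nat).
Hypothesis n13 : (13 <= n)%N.

Let T := broom n.
Let S := points n [:: 0; 1; 2]%N.
Let c (s : 'S_n) : R := signed_sum (hits R S s).
Let hit_count : R := \sum_(s : 'S_n) hits R S s [:: 0; 1; 2]%N.
Let tree_stab := [set a : 'S_n | relabel_action R n (chi R T) a == chi R T]%SET.

Lemma sum_hitsE l : l \in arcs ++ odd_even -> \sum_(s : 'S_n) hits R S s l = hit_count.
Proof. by move=> la; apply: sum_hits_eq; rewrite !card_points. Qed.

Lemma hit_count_gt0 : 0 < hit_count.
Proof.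
rewrite /hit_count (bigD1 1%g) //= ltr_pwDl //; last by apply: sumr_ge0.
rewrite /hits (_ : [set _ | _ in _]%SET = S) ?eqxx //.
by rewrite -[RHS]imset_id; apply: eq_imset => v; rewrite perm1.
Qed.

Lemma sum_coef : \sum_s c s = 4 * hit_count.
Proof.
rewrite /c signed_sum_exchange (eq_signed_sum (F2 := fun=> hit_count)).
  by rewrite /signed_sum !big_cons !big_nil; ring.
by move=> l la; rewrite sum_hitsE.
Qed.

(** The six arcs contain 2, 2, 2, 2, 1 and 1 edges of the tree, and the two alternating triples
    contain none. *)
Lemma sum_coef_weight :
  \sum_s c s * induced_weight S (relabel_action R n (chi R T) s) = 10 * hit_count.
Proof.
rewrite /c; under eq_bigr do rewrite mulrC -signed_sumZ.
rewrite signed_sum_exchange (eq_signed_sum (F2 := fun l => hit_count * (broom_edges_in l)%:R)).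
  by rewrite /signed_sum !big_cons !big_nil /broom_edges_in /=; ring.
move=> l la; rewrite -(sum_hitsE la) mulr_suml; apply: eq_bigr => s _.
rewrite /hits; case: eqVneq => [sl|_]; last by rewrite mulr0 mul0r.
by rewrite (induced_weight_relabel _ sl) induced_weight_chi card_broom_edges // mulrC.
Qed.

Lemma tree_stab_tperm (a b : 'I_n) : (6 <= a)%N -> (6 <= b)%N -> tperm a b \in tree_stab.
Proof.
move=> a6 b6; rewrite inE; apply/eqP/ffunP => e; rewrite !ffunE tpermV.
by rewrite broom_tperm.
Qed.

Lemma relabel_actM (x : vec R (edge n)) (s t : 'S_n) :
  relabel_action R n x (s * t)%g = relabel_action R n (relabel_action R n x s) t.
Proof. exact: vec_relabelM. Qed.

Lemma relabel_act1 (x : vec R (edge n)) : relabel_action R n x 1%g = x.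
Proof. exact: vec_relabel1. Qed.

Lemma tree_stabM s t : t \in tree_stab -> (s * t \in tree_stab)%g = (s \in tree_stab).
Proof.
rewrite !inE => /eqP tT; rewrite relabel_actM; apply/eqP/eqP => [|->//].
rewrite -{2}tT => /(congr1 (relabel_action R n ^~ t^-1%g)).
by rewrite -!relabel_actM mulgV mulg1 relabel_act1.
Qed.

Lemma symmetric_extension_size_ge k :
  symmetric_extension_size (relabel_action R n) (@P_ST R n) k -> ('C(n, 3) <= k)%N.
Proof.
move=> [d [Q [p [[[polyQ pA pQ] [rho [rhoQ rhop]]] Qk]]]].
rewrite leqNgt; apply/negP => ltk.
have [m [g [gA QE]]] := polyhedronP polyQ.
have [rA rQ r1 rM] := rhoQ.
have [q Qq pq] : exists2 q, Q q & p q = chi R T.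
  by have : (p @` Q) (chi R T) by rewrite pQ; apply: P_ST_chi; apply: broom_spanning.
(* The lift [q] need not be fixed by the stabilizer of the tree, so the coefficients are averaged
   over it. By [swap] this amounts to averaging the function, which makes it invariant under
   transpositions of leaves. *)
pose w s := \sum_(a in tree_stab) c (a^-1 * s)%g.
have swap (f : 'S_n -> R) : \sum_s w s * f s =
    \sum_s c s * \sum_(a in tree_stab) f (a * s)%g.
  rewrite /w; under eq_bigr do rewrite mulr_suml.
  under [RHS]eq_bigr do rewrite mulr_sumr.
  rewrite exchange_big [RHS]exchange_big /=; apply: eq_bigr => a _.
  rewrite (reindex_inj (mulgI a)) /=; apply: eq_bigr => s _.
  by rewrite mulKg.
have stab_gt0 : 0 < #|tree_stab|%:R :> R.
  by rewrite ltr0n; apply/card_gt0P; exists 1%g; rewrite inE relabel_act1.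
pose N := #|tree_stab|%:R * (4 * hit_count).
have N0 : 0 < N by rewrite !mulr_gt0 // hit_count_gt0.
have wN : \sum_s w s = N.
  under eq_bigr do rewrite -[w _]mulr1.
  rewrite swap /N -sum_coef mulr_sumr; apply: eq_bigr => s _.
  by rewrite sumr_const mulrC.
pose y := \sum_s (w s / N) *: rho q s.
have w1 : \sum_s w s / N = 1 by rewrite -mulr_suml wN divff // gt_eqF.
have py : induced_weight S (p y) = 5 / 2.
  rewrite /y affine_map_sum_combination // (affine_fun_sum_combination _ (induced_weight_affine R S)) //.
  under eq_bigr do rewrite rhop // pq mulrAC.
  rewrite -mulr_suml swap.
  have -> : \sum_s c s * \sum_(a in tree_stab)
        induced_weight S (relabel_action R n (chi R T) (a * s)%g) =
      #|tree_stab|%:R * (10 * hit_count).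
    rewrite -sum_coef_weight mulr_sumr; apply: eq_bigr => s _.
    rewrite mulrCA; congr (_ * _); rewrite -sumr_const mulr_suml.
    apply: eq_bigr => a; rewrite inE => /eqP aT; by rewrite relabel_actM aT mul1r.
  by rewrite /N; field; rewrite !gt_eqF // hit_count_gt0.
suff Qy : Q y.
  have : @P_ST R n (p y) by rewrite -pQ; exists y.
  by move=> /(P_ST_induced_weight_le (card_points n13 (isT : [:: 0; 1; 2]%N \in arcs ++ odd_even))); rewrite py; lra.
apply: contrapT => nQy; rewrite QE in nQy.
have [||F] := facet_cuts_off gA _ nQy.
- by exists q; rewrite -QE.
(* [y] is an affine combination of points of [Q], so it satisfies the implicit equations of [Q] even
   though some weights may be negative. *)
- move=> k0 gk0; rewrite affine_fun_sum_combination // big1 // => s _.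
  by rewrite gk0 ?mulr0 // -QE; apply: rQ.
rewrite -QE => fF Fcut.
have [H HF Hk] := facet_stabilizer rhoQ Qk fF.
have [l [lA l0 lF lH]] := invariant_facet_functional rhoQ fF HF.
have := Fcut l lA l0 lF; rewrite affine_fun_sum_combination //.
under eq_bigr do rewrite mulrAC.
rewrite -mulr_suml swap pmulr_llt0 ?invr_gt0 // ltNge => /negP; apply.
have Hidx : (#|[set: 'S_n]%SET : H|%g < 'C(#|'I_n|, 3))%N.
  by rewrite card_ord; apply: leq_ltn_trans Hk ltk.
have [|W [cW WH]] := small_index_cyc3 _ Hidx; first by rewrite card_ord.
under eq_bigr do rewrite mulrC.
apply: (invariant_signed_sum_ge0 n13 cW).
- move=> s x1 x2 x3 x1W x2W x3W x12 x23 x13; apply: eq_bigr => a _.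
  by rewrite mulgA rM // lH //; [apply: rQ|apply: WH].
- move=> s a b a6 b6; rewrite [RHS](reindex_inj (mulIg (tperm a b))) /=.
  by apply: eq_big => t; [rewrite tree_stabM // tree_stab_tperm|rewrite mulgA].
- by move=> s; apply: sumr_ge0 => a _; apply/l0/rQ.
- by rewrite card_points.
Qed.

End LowerBound.

(** * Martin's extended formulation *)

Section Farkas.
Variable R : realType.

Lemma dotC (I : finType) (a x : vec R I) : dot a x = dot x a.
Proof. by apply: eq_bigr => i _; rewrite mulrC. Qed.

Lemma dotDl (I : finType) (u v x : vec R I) : dot (u + v) x = dot u x + dot v x.
Proof. by rewrite !(dotC _ x) [LHS]linearD. Qed.

Lemma dotZl (I : finType) (t : R) (u x : vec R I) : dot (t *: u) x = t * dot u x.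
Proof. by rewrite !(dotC _ x) [LHS]linearZ. Qed.

Lemma dotDr (I : finType) (u x y : vec R I) : dot u (x + y) = dot u x + dot u y.
Proof. by rewrite [LHS]linearD. Qed.

Lemma dotZr (I : finType) (t : R) (u x : vec R I) : dot u (t *: x) = t * dot u x.
Proof. by rewrite [LHS]linearZ. Qed.

(** Induction on the number of vectors. If the [x] found for the vectors other than a_0 has a_0.x >
    0, all vectors are projected along a_0 onto the hyperplane orthogonal to [x], and the induction
    hypothesis is applied again. *)
Lemma farkas (I : finType) (m : nat) (a : 'I_m -> vec R I) (b : vec R I) :
  (exists2 w : 'I_m -> R, forall i, 0 <= w i & b = \sum_i w i *: a i) \/
  (exists y, (forall i, dot (a i) y <= 0) /\ 0 < dot b y).
Proof.
elim: m a b => [|m IHm] a b.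
  have [->|b0] := eqVneq b 0; first by left; exists (fun=> 0); rewrite ?big_ord0.
  right; exists b; split; first by case.
  have [i bi] : exists i, b i != 0.
    apply: contrapT => none; case/eqP: b0; apply/ffunP => i; rewrite ffunE.
    by apply: contrapT => bi; apply: none; exists i; apply/eqP.
  rewrite /dot (bigD1 i) //= ltr_pwDl //.
    by rewrite lt_neqAle eq_sym mulf_neq0 // sqr_ge0.
  by apply: sumr_ge0 => j _; rewrite -expr2 sqr_ge0.
pose a1 i := a (lift ord0 i).
have [[w w0 bE]|[x [ax bx]]] := IHm a1 b.
  left; exists (fun i => if unlift ord0 i is Some j then w j else 0).
    by move=> i; case: unliftP => [j _|_].
  rewrite big_ord_recl unlift_none scale0r add0r bE.
  by apply: eq_bigr => i _; rewrite liftK.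
have [a0x|a0x] := leP (dot (a ord0) x) 0.
  right; exists x; split=> // i; case: (unliftP ord0 i) => [j ->|-> //].
  exact: ax.
pose proj (u : vec R I) : vec R I := u + (- (dot u x / dot (a ord0) x)) *: a ord0.
have [[w w0 bE]|[y [ay by_]]] := IHm (proj \o a1) (proj b).
  (* The coefficient of a_0 undoes the projections; it is nonnegative since b.x > 0 and the other
     a_i.x are at most 0. *)
  left; pose c := dot b x / dot (a ord0) x - \sum_i w i * (dot (a1 i) x / dot (a ord0) x).
  exists (fun i => if unlift ord0 i is Some j then w j else c).
    move=> i; case: unliftP => [j _ //|_]; rewrite subr_ge0.
    apply: le_trans (_ : 0 <= _); last by rewrite divr_ge0 // ltW.
    rewrite -oppr_ge0 -sumrN; apply: sumr_ge0 => j _.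
    by rewrite -mulrN mulr_ge0 // -mulNr divr_ge0 ?oppr_ge0 // ltW.
  rewrite big_ord_recl unlift_none.
  have -> : b = proj b + (dot b x / dot (a ord0) x) *: a ord0.
    by rewrite /proj scaleNr subrK.
  rewrite bE /c scalerBl addrC -addrA; congr (_ + _).
  rewrite scaler_suml -sumrN -big_split /=; apply: eq_bigr => i _.
  by rewrite liftK /proj scalerDr scaleNr scalerN scalerA addrC.
right; exists (y + (- (dot (a ord0) y / dot (a ord0) x)) *: x).
have projE u : dot u (y + (- (dot (a ord0) y / dot (a ord0) x)) *: x) = dot (proj u) y.
  by rewrite dotDr dotZr dotDl dotZl; ring.
split=> [i|]; last by rewrite projE.
case: (unliftP ord0 i) => [j ->|->]; first by rewrite projE; apply: ay.
by rewrite dotDr dotZr mulNr divfK ?subrr // gt_eqF.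
Qed.

Lemma separate_convex_hull (I K : finType) (v : K -> vec R I) (x : vec R I) :
  ~ convex_hull (range v) x -> exists c, forall k, dot c (v k) < dot c x.
Proof.
(* The extra coordinate 1 turns convex combinations into conic ones. *)
move=> nhull; pose hom (u : vec R I) : vec R (option I) := [ffun o => if o is Some i then u i else 1].
have [[w w0 xE]|[y [vy xy]]] := farkas (fun i : 'I_#|K| => hom (v (enum_val i))) (hom x).
  case: nhull; exists #|K|, w, (fun i => v (enum_val i)); split=> //.
  - have := congr1 (fun f : vec R (option I) => f None) xE.
    rewrite /= ffunE sum_ffunE => ->; apply: eq_bigr => i _.
    by rewrite !ffunE /GRing.scale /= mulr1.
  - apply/ffunP => i; have := congr1 (fun f : vec R (option I) => f (Some i)) xE.
    rewrite /= ffunE !sum_ffunE => ->; apply: eq_bigr => k _.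
    by rewrite !ffunE.
have homE u : dot (hom u) y = dot u [ffun i => y (Some i)] + y None.
  rewrite /dot (bigD1 None) //= ffunE mul1r addrC; congr (_ + _).
  rewrite (reindex_omap Some id) /=; last by case.
  by apply: eq_big => [i|i _]; rewrite ?eqxx // !ffunE.
exists [ffun i => y (Some i)] => k; rewrite !(dotC [ffun _ => _]).
move: xy (vy (enum_rank k)); rewrite enum_rankK !homE; lra.
Qed.
End Farkas.

Section AffineClosure.
Variable R : realType.

Lemma affine_fun_coord (I : finType) (i : I) : affine_fun (fun x : vec R I => x i).
Proof.
exists [ffun j => (j == i)%:R], 0 => x; rewrite addr0 /dot (bigD1 i) //= ffunE eqxx mul1r.
by rewrite big1 ?addr0 // => j ji; rewrite ffunE (negbTE ji) mul0r.
Qed.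

Lemma affine_fun_cst (I : finType) (a : R) : affine_fun (fun _ : vec R I => a).
Proof.
by exists 0, a => x; rewrite /dot big1 ?add0r // => i _; rewrite ffunE mul0r.
Qed.

Lemma affine_funD (I : finType) (f g : vec R I -> R) :
  affine_fun f -> affine_fun g -> affine_fun (fun x => f x + g x).
Proof.
move=> [c [b fE]] [c' [b' gE]]; exists (c + c'), (b + b') => x.
by rewrite fE gE dotDl; ring.
Qed.

Lemma affine_funM (I : finType) (a : R) (f : vec R I -> R) :
  affine_fun f -> affine_fun (fun x => a * f x).
Proof.
by move=> [c [b fE]]; exists (a *: c), (a * b) => x; rewrite fE dotZl mulrDr.
Qed.

Definition dots (I J : finType) (c : J -> vec R I) (x : vec R I) : vec R J :=
  [ffun j => dot (c j) x].

Lemma dots_linear (I J : finType) (c : J -> vec R I) : linear (dots c).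
Proof.
by move=> a x y; apply/ffunP => j; rewrite !ffunE dotDr dotZr.
Qed.

HB.instance Definition _ (I J : finType) (c : J -> vec R I) :=
  GRing.isLinear.Build R (vec R I) (vec R J) _ (dots c) (dots_linear c).

Lemma affine_map_coords (I J : finType) (f : vec R I -> vec R J) :
  (forall j, affine_fun (fun x => f x j)) -> affine_map f.
Proof.
move=> fA; have /boolp.choice [cb fE] : forall j, exists cb : vec R I * R,
    forall x, f x j = dot cb.1 x + cb.2.
  by move=> j; have [c [b fE]] := fA j; exists (c, b).
exists (dots (fun j => (cb j).1) : {linear vec R I -> vec R J}), [ffun j => (cb j).2].
by move=> x; apply/ffunP => j; rewrite !ffunE fE.
Qed.

Lemma polyhedron_constraints (I K : finType) (g : K -> vec R I -> R) :
  (forall k, affine_fun (g k)) -> polyhedron [set x | forall k, 0 <= g k x].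
Proof.
move=> gA; have /boolp.choice [cb gE] : forall k, exists cb : vec R I * R,
    forall x, g k x = dot cb.1 x + cb.2.
  by move=> k; have [c [b gE]] := gA k; exists (c, b).
exists #|K|, (fun i => - (cb (enum_val i)).1), (fun i => (cb (enum_val i)).2).
have dotN (c x : vec R I) : dot (- c) x = - dot c x by rewrite -scaleN1r dotZl mulN1r.
apply/seteqP; split => x /= gx i; first by rewrite dotN; have := gx (enum_val i); rewrite gE; lra.
by have := gx (enum_rank i); rewrite enum_rankK dotN gE; lra.
Qed.

End AffineClosure.

Section MartinPolyhedron.
Variables (R : realType) (n : nat).
Hypothesis n0 : (0 < n)%N.

Let J := ('I_n * 'I_n * 'I_n)%type.
Let d := #|{: J}|.

Definition flow (x : vec R 'I_d) (k i j : 'I_n) : R := x (enum_rank (k, i, j)).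

Definition of_flow (z : 'I_n -> 'I_n -> 'I_n -> R) : vec R 'I_d :=
  [ffun a => let: (k, i, j) := enum_val a in z k i j].

Lemma flowK z k i j : flow (of_flow z) k i j = z k i j.
Proof. by rewrite /flow ffunE enum_rankK. Qed.

Lemma flow_inj x y : (forall k i j, flow x k i j = flow y k i j) -> x = y.
Proof.
move=> xy; apply/ffunP => a; have := xy (enum_val a).1.1 (enum_val a).1.2 (enum_val a).2.
by rewrite /flow -!surjective_pairing enum_valK.
Qed.

Let Eqn := (J + 'I_n * 'I_n + 'I_n * J)%type.

(** The boolean factors make an equation trivial where its side condition fails, so that all index
    triples and pairs can be used. *)
Definition martin_equation (e : Eqn) (x : vec R 'I_d) : R :=
  match e with
  | inl (inl (k, i, j)) => ((i == k) || (i == j))%:R * flow x k i j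
  | inl (inr (k, i)) => (i != k)%:R * (\sum_j flow x k i j - 1)
  | inr (l, (k, i, j)) =>
      (flow x k i j + flow x k j i) + (-1) * (flow x l i j + flow x l j i)
  end.

(** Equations enter as pairs of opposite inequalities. These vanish on the polyhedron, so only the
    n^3 sign constraints can define facets. *)
Definition martin_constraint (c : J + Eqn * bool) (x : vec R 'I_d) : R :=
  match c with
  | inl (k, i, j) => flow x k i j
  | inr (e, b) => (-1) ^+ b * martin_equation e x
  end.

Definition martin_polyhedron : set (vec R 'I_d) :=
  [set x | forall c, 0 <= martin_constraint c x].

Lemma flow_affine k i j : affine_fun (fun x => flow x k i j).
Proof. exact: affine_fun_coord. Qed.

Lemma martin_constraint_affine c : affine_fun (martin_constraint c).
Proof.
case: c => [[[k i] j]|[e b]]; first exact: flow_affine.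
apply: affine_funM; case: e => [[[[k i] j]|[k i]]|[l [[k i] j]]].
- by apply: affine_funM; apply: flow_affine.
- apply/affine_funM/affine_funD; last exact: affine_fun_cst.
  by apply: affine_fun_sum => j _; apply: flow_affine.
- apply: affine_funD; first by apply: affine_funD; apply: flow_affine.
  by apply/affine_funM/affine_funD; apply: flow_affine.
Qed.

Lemma martin_equation0 x e : martin_polyhedron x -> martin_equation e x = 0.
Proof.
move=> xM; have := xM (inr (e, false)); have := xM (inr (e, true)).
by rewrite /= expr0 expr1; lra.
Qed.

Lemma martin_polyhedronP x : martin_polyhedron x <-> martin (flow x).
Proof.
split=> [xM|[z0 zk zd z1 zz] c].
  have xE e := martin_equation0 e xM; split.
  - by move=> k i j; apply: (xM (inl (k, i, j))).
  - by move=> k j; have := xE (inl (inl (k, k, j))); rewrite /= eqxx mul1r.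
  - by move=> k i; have := xE (inl (inl (k, i, i))); rewrite /= eqxx orbT mul1r.
  - move=> k i ik; have := xE (inl (inr (k, i))); rewrite /= ik mul1r => /eqP.
    by rewrite subr_eq0 => /eqP.
  - by move=> k l i j; have := xE (inr (l, (k, i, j))); rewrite /= ; lra.
case: c => [[[k i] j]|[e b]]; first exact: z0.
rewrite /= (_ : martin_equation e x = 0) ?mulr0 //.
case: e => [[[[k i] j]|[k i]]|[l [[k i] j]]] /=.
- by case: eqVneq => [->|_]; [rewrite zk mulr0|case: eqVneq => [->|_]; rewrite ?zd ?mulr0 ?mul0r].
- by case: eqVneq => ik /=; rewrite ?mul0r // z1 ?subrr ?mulr0.
- by rewrite (zz k l); ring.
Qed.

Lemma martin_nb_facets : exists2 m, (m <= n ^ 3)%N & has_nb_facets martin_polyhedron m.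
Proof.
pose N : {set J + Eqn * bool} := [set inl a | a in [set: J]]%SET.
have [|m mN fm] := has_nb_facets_le (N := N) martin_constraint_affine.
  move=> [a|[e b]] x; first by rewrite imset_f ?inE.
  by move=> _ xM /=; rewrite martin_equation0 ?mulr0.
exists m => //; apply: leq_trans mN _; rewrite card_imset; last by move=> a b [].
by rewrite cardsT !card_prod !card_ord !expnS expn0 muln1 mulnA.
Qed.

Definition flow_proj (x : vec R 'I_d) : vec R (edge n) :=
  [ffun e => edge_weight (flow x) e].

Lemma flow_proj_affine : affine_map flow_proj.
Proof.
apply: affine_map_coords => e; have -> : (fun x => flow_proj x e) = (fun x => edge_weight (flow x) e).
  by apply/funext => x; rewrite ffunE.
apply/affine_funM/affine_fun_sum => k _; apply: affine_fun_sum => a _.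
exact: flow_affine.
Qed.

Definition flow_relabel (x : vec R 'I_d) (s : 'S_n) : vec R 'I_d :=
  of_flow (fun k i j => flow x (s^-1%g k) (s^-1%g i) (s^-1%g j)).

Lemma flow_relabel_action : affine_action_on martin_polyhedron flow_relabel.
Proof.
split.
- move=> s; apply: affine_map_coords => a; case aE : (enum_val a) => [[k i] j].
  have -> : (fun x => flow_relabel x s a) =
      (fun x => flow x (s^-1%g k) (s^-1%g i) (s^-1%g j)).
    by apply/funext => x; rewrite ffunE aE.
  exact: flow_affine.
- move=> x s /martin_polyhedronP [z0 zk zd z1 zz]; apply/martin_polyhedronP; split.
  + by move=> k i j; rewrite flowK.
  + by move=> k j; rewrite flowK.
  + by move=> k i; rewrite flowK.
  + move=> k i ik; under eq_bigr do rewrite flowK.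
    rewrite -(z1 (s^-1%g k) (s^-1%g i)) ?(inj_eq perm_inj) //.
    by rewrite [RHS](reindex_inj (@perm_inj _ s^-1%g)).
  + by move=> k l i j; rewrite !flowK.
- by move=> x _; apply: flow_inj => k i j; rewrite flowK invg1 !perm1.
- by move=> x s t _; apply: flow_inj => k i j; rewrite !flowK invMg !permM.
Qed.

Lemma flow_proj_relabel x (s : 'S_n) :
  flow_proj (flow_relabel x s) = relabel_action R n (flow_proj x) s.
Proof.
apply/ffunP => e; rewrite !ffunE /edge_weight; congr (_ * _).
rewrite [RHS](reindex_inj (@perm_inj _ s^-1%g)) /=; apply: eq_bigr => k _.
pose h (a : 'I_n * 'I_n) := (s^-1%g a.1, s^-1%g a.2).
have h_inj : injective h by move=> [a b] [a' b'] [/perm_inj-> /perm_inj->].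
rewrite [RHS](reindex_inj h_inj) /=; apply: eq_big => [a|a _]; last by rewrite flowK.
rewrite /ends_of /= -(inj_eq (imset_inj (@perm_inj _ s^-1%g))).
by rewrite imsetU1 imset_set1.
Qed.

Lemma martin_proj_sub x : martin_polyhedron x -> @P_ST R n (flow_proj x).
Proof.
move=> /martin_polyhedronP zM.
pose K := {T : {set edge n} | `[< spanning_tree T >]}.
apply: contrapT => nx.
have [|c cT] := @separate_convex_hull R _ K (fun T => chi R (val T)) (flow_proj x).
  apply: contra_not nx => -[k [w [y [yT w0 w1 xE]]]]; exists k, w, y; split=> // i.
  by have [T _ <-] := yT i; exists (val T) => //; apply/asboolP/(valP T).
have [T Tst cle] := greedy_spanning_tree zM n0 c.
have := cT (exist _ T (introT (asboolP _) Tst)); rewrite ltNge => /negP; apply.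
rewrite /dot /=; under eq_bigr do rewrite ffunE.
apply: le_trans cle _; rewrite big_mkcond /=; apply: ler_sum => e _.
by rewrite ffunE; case: (e \in T); rewrite ?mulr1 ?mulr0.
Qed.

Lemma spanning_tree_lift T : spanning_tree T ->
  exists2 x, martin_polyhedron x & flow_proj x = chi R T.
Proof.
move=> Tst; pose x := of_flow (fun k i j => (towards T k i j)%:R).
exists x.
  apply/martin_polyhedronP; split.
  - by move=> k i j; rewrite flowK.
  - by move=> k j; rewrite flowK towards_root.
  - by move=> k i; rewrite flowK towards_diag.
  - by move=> k i ik; under eq_bigr do rewrite flowK; apply: sum_towards.
  - by move=> k l i j; rewrite !flowK -!natrD !towardsC.
apply/ffunP => e; rewrite !ffunE /edge_weight; have [u [v [uv eE]]] := edge_ends e.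
rewrite (eq_bigr (fun=> (e \in T)%:R)) => [|k _].
  by rewrite sumr_const card_ord -[X in _ * X]mulr_natl mulKf // pnatr_eq0 -lt0n.
by rewrite (sum_ends _ uv eE) /= !flowK -natrD towardsC // (adj_edge T eE).
Qed.

Lemma martin_proj : flow_proj @` martin_polyhedron = @P_ST R n.
Proof.
apply/seteqP; split => [_ [x xM <-]|_ [k [w [y [yT w0 w1 ->]]]]].
  exact: martin_proj_sub.
have /boolp.choice [q qE] : forall i, exists q, martin_polyhedron q /\ flow_proj q = y i.
  by move=> i; have [T /spanning_tree_lift[q qM qT] <-] := yT i; exists q.
exists (\sum_i w i *: q i).
  move=> c; rewrite (affine_fun_sum_combination _ (martin_constraint_affine c) w1).
  by apply: sumr_ge0 => i _; rewrite mulr_ge0 //; apply: (qE i).1.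
rewrite (affine_map_sum_combination _ flow_proj_affine w1).
by apply: eq_bigr => i _; rewrite (qE i).2.
Qed.

Lemma symmetric_extension_size_le :
  exists2 m, (m <= n ^ 3)%N & symmetric_extension_size (relabel_action R n) (@P_ST R n) m.
Proof.
have [m mn fm] := martin_nb_facets; exists m => //.
exists d, martin_polyhedron, flow_proj; split=> //; split.
  split; [exact/polyhedron_constraints/martin_constraint_affine
    |exact: flow_proj_affine|exact: martin_proj].
exists flow_relabel; split; first exact: flow_relabel_action.
by move=> s x _; apply: flow_proj_relabel.
Qed.

End MartinPolyhedron.

(** * The two bounds combined *)

Lemma xcs_P_ST_bounds (R : realType) (n : nat) : (13 <= n)%N ->
  ('C(n, 3) <= xcs_P_ST R n <= n ^ 3)%N.
Proof.
move=> n13; have n0 : (0 < n)%N by lia.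
have [m mn /xcs_min[sx xm]] := symmetric_extension_size_le R n0.
by rewrite (symmetric_extension_size_ge n13 sx) (leq_trans xm mn).
Qed.

Theorem theorem1p1 (R : realType) :
  (forall n : nat, (13 <= n)%N -> ('C(n, 3) <= xcs_P_ST R n)%N) /\
  (fun n : nat => (xcs_P_ST R n)%:R : R^o) =Theta_\oo
    (fun n : nat => n%:R ^+ 3 : R^o).
Proof.
split=> [n /(xcs_P_ST_bounds R)/andP[]//|].
(* The constant 1/24 comes from 24 C(n, 3) = 4n(n - 1)(n - 2) >= n^3. *)
rewrite eqThetaE qualifE; apply/asboolP; exists (24^-1, 1) => /=.
  by rewrite invr_gt0 ltr0n ltr01.
exists 13%N => // n /= n13; have /andP[ge le] := xcs_P_ST_bounds R n13.
have absn (m : nat) : `|m%:R : R^o| = m%:R :> R by rewrite ger0_norm.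
rewrite -natrX !absn mul1r ler_nat; split=> //.
rewrite mulrC ler_pdivrMr // -natrM ler_nat.
apply: leq_trans (leq_mul ge (leqnn 24)).
have e : ('C(n, 3) * 6 = n * n.-1 * n.-2)%N.
  have -> : 6%N = 3`! by [].
  by rewrite bin_ffact !ffactnS ffactn0; lia.
by rewrite !expnS expn0; nia.
Qed.
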